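(* Let $N\ge 2$, $\beta=0$, $\alpha,\gamma,\mu>0$ and $0<T<\infty$. Then a symmetric equilibrium arrival distribution of the $(N+1)$-customer game with closing time $T$ satisfies the following properties. If arriving before time zero is allowed (any $t\le T$ is an admissible arrival time), then: (1) The support of the equilibrium arrival distribution is a finite interval $[t_a,T]$, where $t_a<-N\frac{\gamma}{\alpha}$. (2) The expected cost of every customer in equilibrium is larger than $N\gamma$. If arriving before time zero is not allowed (only $t\in[0,T]$ is admissible), then: (3) There is a positive probability to arrive at time zero. Denote it by $p_0$. If $$\frac{N}{2}\left(1-\frac{\gamma\mu}{\alpha}\right)\le q_1(T),$$ then $p_0=1$; otherwise $p_0<1$. (4) The condition $\frac{\alpha}{\mu}\le\gamma$ is sufficient (but not necessary) for $p_0=1$. (5) If $p_0<1$, then the remaining support (other than the atom at $0$) is an interval $[t_e,T]$, where $t_e\in(0,T)$.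
   Context: Model. There are $N+1$ customers, each choosing (possibly at random, independently) an arrival time. A single server starts operating at time $0$ and serves First Come First Served; service times are i.i.d. exponential with rate $\mu$. No arrivals are possible after the closing time $T$, but all customers who arrived by time $T$ are served, even after $T$. Customers arriving at exactly the same time are admitted in uniformly random order. Each customer pays $\alpha$ per unit of time from arrival until admission into service, and $\gamma$ for every customer ahead of him in the arrival order. When the other $N$ customers arrive independently according to a cdf $F$, the expected cost of arriving at $t$ is $$c_F(t)=-\alpha t\,\mathbf{1}_{\{t<0\}}+\frac{\alpha}{\mu}\mathbb{E}Q_F(t)+\gamma\,\mathbb{E}A_F(t),$$ where $A_F(t)$ is the number of the other customers that have arrived up to time $t$ and $Q_F(t)$ is the number of them present in the system (in queue or in service) at time $t$; if $F$ has an atom at $t$, then of the customers arriving exactly at $t$ only those placed ahead by the random tie-breaking are counted. A symmetric equilibrium arrival distribution is a cdf $F$ for which there is a constant $c_e$ (the equilibrium cost) such that $c_F(t)=c_e$ for all $t$ in the support of $F$ and $c_F(t)\ge c_e$ for every admissible arrival time $t$. Only distributions $F$ whose support is, on any finite interval, a finite union of closed intervals and points are considered. For $p\in[0,1]$ and $t>0$, $q_p(t)$ denotes the expected number of customers in the system at time $t$ if each of the $N$ other customers arrives at time zero with probability $p$ (independently) and with probability zero in $(0,t]$: $$q_p(t)=\sum_{j=0}^{N}\binom{N}{j}p^j(1-p)^{N-j}\sum_{i=0}^{j}(j-i)\frac{e^{-\mu t}(\mu t)^i}{i!}.$$ In particular $q_1(T)=\sum_{i=0}^{N}(N-i)\frac{e^{-\mu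 T}(\mu T)^i}{i!}$. *)

(* Defs.v *)
From HB Require Import structures.
From mathcomp Require Import all_boot all_order all_algebra perm.
From mathcomp Require Import all_classical all_reals all_analysis.

Set Implicit Arguments.
Unset Strict Implicit.
Unset Printing Implicit Defensive.
Import Order.TTheory GRing.Theory Num.Theory.
Import numFieldNormedType.Exports.

Local Open Scope classical_set_scope.
Local Open Scope ring_scope.

Section iid.
Context d (T : measurableType d) (R : realType).

Definition tcons n (p : T * n.-tuple T) : n.+1.-tuple T :=
  [the n.+1.-tuple T of p.1 :: p.2].

Lemma measurable_tcons n : measurable_fun [set: T * n.-tuple T] (@tcons n).
Proof. exact: measurable_cons. Qed.

HB.instance Definition _ n :=
  isMeasurableFun.Build _ _ _ _ (@tcons n) (@measurable_tcons n).

(* The n-fold product of P, i.e. the joint law of n independent draws from P. *)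
Fixpoint iid (P : probability T R) n : probability (n.-tuple T) R :=
  if n is m.+1 then distribution (P \x iid P m)%E (@tcons m)
  else \d_[tuple of [::]].

End iid.

(* A sample path with n customers is a tuple w whose i-th entry is the pair
   (arrival time, service time) of customer i; the permutation s holds the
   random ranks that order the customers who arrive simultaneously. *)
Section queue.
Context (R : realType) (n : nat) (s : 'S_n) (w : n.-tuple (R * R)).

Definition arrival (i : 'I_n) : R := (tnth w i).1.
Definition service (i : 'I_n) : R := (tnth w i).2.

Definition ahead (i j : 'I_n) : bool :=
  (arrival i < arrival j) || (arrival i == arrival j) && (s i < s j)%N.

(* Under First Come First Served, the service of j starts at the latest of:
   the opening time 0, the arrival of j, the departures of all customers
   ahead of j. *)
Definition departure_step (D : 'I_n -> R) (j : 'I_n) : R :=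
  Num.max (arrival j) (\big[Num.max/0]_(i | ahead i j) D i) + service j.

(* n rounds suffice because a customer has fewer than n customers ahead;
   see departureE. *)
Definition departure : 'I_n -> R := iter n departure_step (fun=> 0).

Definition num_ahead (j : 'I_n) : nat := #|[pred i | ahead i j]|.

Definition num_present (j : 'I_n) : nat :=
  #|[pred i | ahead i j && (arrival j < departure i)]|.

Lemma ahead_trans i j k : ahead i j -> ahead j k -> ahead i k.
Proof.
rewrite /ahead => /orP[ij|/andP[/eqP -> ij]] /orP[jk|/andP[/eqP jk' jk]].
- by rewrite (lt_trans ij jk).
- by rewrite -jk' ij.
- by rewrite jk.
- by rewrite jk' eqxx (ltn_trans ij jk) orbT.
Qed.

Lemma ahead_irr i : ahead i i = false.
Proof. by rewrite /ahead ltxx ltnn andbF. Qed.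

Lemma departureE j : departure j = departure_step departure j.
Proof.
have lt_ahead i k : ahead i k -> (num_ahead i < num_ahead k)%N.
  move=> ik; apply/proper_card/properP; split.
    by apply/fintype.subsetP => l; rewrite !inE => /ahead_trans; apply.
  by exists i; rewrite !inE ?ahead_irr.
suff stab m k : (num_ahead k < m)%N ->
    iter m departure_step (fun=> 0) k = iter m.+1 departure_step (fun=> 0) k.
  rewrite /departure stab //.
  rewrite -[X in (_ < X)%N]card_ord; apply/proper_card/properP; split.
    exact/fintype.subsetP.
  by exists j; rewrite // inE ahead_irr.
elim: m k => // m IH k km.
rewrite [in LHS]iterS [in RHS]iterS {1 3}/departure_step; congr (Num.max _ _ + _).
apply: eq_bigr => i ik; apply: IH.
exact: leq_trans (lt_ahead _ _ ik) km.
Qed.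

End queue.

Section game.
Context (R : realType).
Implicit Types (F : cumulativeBounded (0 : R) (1 : R)) (t : R).

(* The probability distribution on the line whose cdf is F. *)
Definition law F : probability (measurableTypeR R) R :=
  lebesgue_stieltjes_measure F.

Definition atom F t : R := fine (law F [set t]).

Definition law_support F : set R :=
  [set x | forall U : set R, open U -> U x -> (0 < law F U)%E].

(* An isolated point x is the degenerate interval [x, x]. *)
Definition locally_finite_union (A : set R) : Prop :=
  forall a b : R, exists s : seq (R * R),
    A `&` `[a, b] = \bigcup_(I in [set` s]) `[I.1, I.2]%classic.

(* exponential_prob mu, as a probability measure. *)
Definition service_law (mu : R) (mu_gt0 : 0 < mu) :
    probability (measurableTypeR R) R :=
  @exponential_distribution_exponential_prob__canonical__probability_measure_Probability
    R mu mu_gt0.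

Section cost.
Context (N : nat) (alpha gamma mu : R) (mu_gt0 : 0 < mu).

(* Arrival and service times of the N other customers. *)
Definition others_law F := iid (law F \x service_law mu_gt0)%E N.

(* Customer ord0 arrives at t and the N others behave according to others_law;
   the expectation is also taken over the uniformly random ranks s. The service
   time 0 given to customer ord0 is irrelevant: it only affects the departures
   of customer ord0 and of those behind him. *)
Definition mean_at (f : 'S_N.+1 -> N.+1.-tuple (R * R) -> 'I_N.+1 -> nat)
    F t : R :=
  fine 'E_(others_law F)[fun w : N.-tuple (R * R) =>
    (N.+1`!%:R)^-1 *
      \sum_(s : 'S_N.+1) (f s [tuple of (t, 0) :: w] ord0)%:R].

(* E A_F(t) and E Q_F(t). *)
Definition mean_A F t : R := mean_at (@num_ahead R N.+1) F t.

Definition mean_Q F t : R := mean_at (@num_present R N.+1) F t.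

Definition cost F t : R :=
  (if t < 0 then - alpha * t else 0) + alpha / mu * mean_Q F t
  + gamma * mean_A F t.

Definition equilibrium (admissible : set R) F (c_e : R) : Prop :=
  [/\ law F admissible = 1%E,
      locally_finite_union (law_support F),
      (forall t, law_support F t -> cost F t = c_e)
    & forall t, admissible t -> c_e <= cost F t].

Definition q (p t : R) : R :=
  \sum_(j < N.+1) 'C(N, j)%:R * p ^+ j * (1 - p) ^+ (N - j) *
    \sum_(i < j.+1) (j - i)%:R * (expR (- (mu * t)) * (mu * t) ^+ i / i`!%:R).

End cost.

End game.

(* Main.v *)
(* In equilibrium the cost is constant on the support and nowhere smaller, so
   each structural claim is proved by exhibiting a cheaper arrival time. Arriving
   just before an atom overtakes, on average, half of it and costs nothing extra
   in the limit because departure times have no atoms; hence only the first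
   admissible instant can carry one. If nobody arrives between a point a of the
   support and b > a, then arriving at b is cheaper, since the queue strictly
   drains in between; hence the support has no gaps and reaches T. Comparing the
   costs at the two ends of the support then gives the inequalities. For the
   value of the atom at zero, the comparison is with the queue at T when all N
   arrive at zero: the k-th customer served departs no earlier than the sum of
   the first k services, an Erlang variable independent of the order of service,
   so q_1(T) is a lower bound for E Q_F(T). *)
From HB Require Import structures.
Require Import Defs.
From mathcomp Require Import all_boot all_order all_algebra perm.
From mathcomp Require Import all_classical all_reals all_analysis.
From mathcomp Require Import measurable_realfun ring lra.

Set Implicit Arguments.
Unset Strict Implicit.
Unset Printing Implicit Defensive.
Import Order.TTheory GRing.Theory Num.Theory.
Import numFieldNormedType.Exports.

Local Open Scope classical_set_scope.
Local Open Scope ring_scope.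

(** * Sample paths of the queue *)

(** Costs at two arrival times are compared on one and the same sample path. Under First Come First
    Served the tagged customer [ord0] never delays those ahead of him, so moving his arrival changes
    who is ahead but not when those customers depart. At fixed ranks [s] and a fixed other customer
    [i], such a comparison reduces to an inclusion of events up to a null or small event. Atoms are
    the delicate point. The argument from a draining queue requires that the left end of the gap
    carry no mass: arriving after an atom rather than inside it puts the other half of the atom
    ahead as well. When early arrivals are forbidden it thus fails at time 0 only, which is why the
    support may split there into 0 and a separate interval. Sample paths carry no sign condition on
    services. Lower bounds on departures hold on every path; upper bounds need nonnegative services,
    which hold only almost surely. *)

Section paths.
Context (R : realType) (n : nat) (s : 'S_n).
Implicit Types (w : n.-tuple (R * R)) (i j l : 'I_n).

Lemma ahead_ltn w i j : ahead s w i j -> (num_ahead s w i < num_ahead s w j)%N.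
Proof.
move=> ij; apply/proper_card/properP; split.
  by apply/fintype.subsetP => l; rewrite !inE => /ahead_trans; apply.
by exists i; rewrite !inE ?ahead_irr.
Qed.

Lemma ahead_total w i j : i != j -> ahead s w i j || ahead s w j i.
Proof.
move=> ij; rewrite /ahead.
have sij : s i != s j by rewrite (inj_eq perm_inj).
by case: ltgtP => //= _; rewrite -neq_ltn.
Qed.

Lemma ahead_ind w (P : 'I_n -> Prop) :
  (forall j, (forall i, ahead s w i j -> P i) -> P j) -> forall j, P j.
Proof.
move=> IH j; have [m] := ubnP (num_ahead s w j).
elim: m j => // m IHm j jm; apply: IH => i ij; apply: IHm.
by rewrite (leq_trans (ahead_ltn ij)).
Qed.

Definition ahead_or_self w j : {set 'I_n} := [set i | (i == j) || ahead s w i j].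

Lemma sum_ahead_or_self w j : \sum_(i in ahead_or_self w j) service w i =
  \sum_(i | ahead s w i j) service w i + service w j.
Proof.
rewrite (bigD1 j) ?inE ?eqxx//= addrC; congr (_ + _).
apply: eq_bigl => i; rewrite !inE.
by have [->|] := eqVneq i j; rewrite ?ahead_irr ?andbT.
Qed.

Lemma arrival_service_le_departure w j :
  arrival w j + service w j <= departure s w j.
Proof. by rewrite departureE /departure_step lerD2r le_max lexx. Qed.

Lemma ahead_service_le_departure w i j : ahead s w i j ->
  departure s w i + service w j <= departure s w j.
Proof.
move=> ij; rewrite [leRHS]departureE /departure_step lerD2r le_max.
by rewrite (bigD1 i)//= le_max lexx orbT.
Qed.

Lemma service_le_departure w j : service w j <= departure s w j.
Proof.
(* The initial value 0 of the iterated maximum stands for the opening time. *)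
rewrite departureE /departure_step lerDr le_max; apply/orP; right.
by rewrite bigmax_ge_id.
Qed.

(* The customers ahead of j are the last of them, l, and those ahead of l. *)
Lemma sum_service_le_departure w j :
  \sum_(i in ahead_or_self w j) service w i <= departure s w j.
Proof.
elim/(@ahead_ind w): j => j IH.
have [l0 l0j|noahead] := pickP (ahead s w ^~ j); last first.
  by rewrite sum_ahead_or_self big_pred0// add0r service_le_departure.
rewrite sum_ahead_or_self.
case: (@arg_maxnP _ l0 (ahead s w ^~ j) (num_ahead s w) l0j) => l lj lmax.
apply: le_trans (ahead_service_le_departure lj); rewrite lerD2r.
apply: le_trans (IH _ lj); rewrite le_eqVlt; apply/orP; left; apply/eqP.
apply: eq_bigl => i; rewrite inE; have [->//|il] := eqVneq i l.
apply/idP/idP => /= [ij|/ahead_trans]; last exact.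
have /orP[//|li] := ahead_total w il.
by have := leq_ltn_trans (lmax _ ij) (ahead_ltn li); rewrite ltnn.
Qed.

(** Once the server is open and [j] has arrived, the server works without pause on [j] and those
    ahead until [j] leaves. Nonnegative services let the induction replace the customers ahead of
    [i] by the larger set of those ahead of [j]. *)
Lemma departure_le_sum_service w j : (forall i, 0 <= service w i) ->
  departure s w j <=
    Num.max 0 (arrival w j) + \sum_(i in ahead_or_self w j) service w i.
Proof.
move=> s0; elim/(@ahead_ind w): j => j IH.
rewrite departureE /departure_step sum_ahead_or_self addrA lerD2r.
have S0 : 0 <= \sum_(i | ahead s w i j) service w i by exact: sumr_ge0.
rewrite ge_max; apply/andP; split.
  by rewrite -[leLHS]addr0 lerD// le_max lexx orbT.
apply: bigmax_le => [|i ij]; first by rewrite addr_ge0// le_max lexx.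
apply: le_trans (IH i ij) _; apply: lerD.
  rewrite ge_max !le_max lexx/=; apply/orP; right.
  by case/orP : ij => [/ltW//|/andP[/eqP->]].
rewrite [leRHS]big_mkcond [leLHS]big_mkcond ler_sum// => k _.
have [ki|_] := ifP; last by case: ifP.
suff -> : ahead s w k j by [].
by move: ki; rewrite inE => /orP[/eqP->//|/ahead_trans]; exact.
Qed.

(* Busy-period decomposition: m is the time the current busy period began. *)
Lemma departure_decomposition w j : exists m (B : {set 'I_n}),
  [/\ j \in B, B \subset ahead_or_self w j, m = 0 \/ exists i, m = arrival w i &
      departure s w j = m + \sum_(i in B) service w i].
Proof.
elim/(@ahead_ind w): j => j IH.
have start m : m = 0 \/ (exists i, m = arrival w i) ->
    exists m' (B : {set 'I_n}),
  [/\ j \in B, B \subset ahead_or_self w j, m' = 0 \/ exists i, m' = arrival w i &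
      m + service w j = m' + \sum_(i in B) service w i].
  move=> m0; exists m, [set j]%SET; rewrite inE eqxx big_set1; split => //.
  by rewrite finset.sub1set inE eqxx.
rewrite departureE /departure_step.
have [h|h] := leP (\big[Num.max/0]_(i | ahead s w i j) departure s w i) (arrival w j).
  by apply: start; right; exists j.
have [->|[i ij ->]] : \big[Num.max/0]_(i | ahead s w i j) departure s w i = 0 \/
    exists2 i, ahead s w i j &
      \big[Num.max/0]_(i | ahead s w i j) departure s w i = departure s w i.
  elim/big_rec : _ => [|i x ij [->|[k kj ->]]]; first by left.
    by rewrite /Num.max; case: ifP => _; [left|right; exists i].
  by right; rewrite /Num.max; case: ifP => _; [exists k|exists i].
  by apply: start; left.
have [m [B [iB Bi m0 ->]]] := IH _ ij.
exists m, (j |: B)%SET; rewrite setU11 big_setU1/=; last first.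
  apply/negP => /(fintype.subsetP Bi); rewrite inE => /orP[/eqP ji|/ahead_trans].
    by move: ij; rewrite ji ahead_irr.
  by move=> /(_ _ ij); rewrite ahead_irr.
split => //; last by rewrite -addrA (addrC (service w j)).
rewrite finset.subUset finset.sub1set inE eqxx/=.
apply/fintype.subsetP => l /(fintype.subsetP Bi); rewrite !inE => /orP[/eqP->|li].
  by rewrite ij orbT.
by rewrite (ahead_trans li ij) orbT.
Qed.



(** A change in the data of [k] is not felt by anyone who stays ahead of [k]. With [k] the tagged
    customer, this couples the queues seen at two arrival times. *)
Lemma departure_local w w' k j :
  (forall i, i != k -> tnth w i = tnth w' i) ->
  ahead s w j k -> ahead s w' j k -> departure s w j = departure s w' j.
Proof.
move=> eww'; elim/(@ahead_ind w): j => j IH jk jk'.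
have eqk i : ahead s w i k -> tnth w i = tnth w' i.
  by move=> ik; apply: eww'; apply: contraTneq ik => ->; rewrite ahead_irr.
have ej := eqk j jk.
have aheadE i : ahead s w i j = ahead s w' i j.
  have [->|ik] := eqVneq i k; last by rewrite /ahead /arrival ej eww'.
  apply/idP/idP => kj; first by move: (ahead_trans kj jk); rewrite ahead_irr.
  by move: (ahead_trans kj jk'); rewrite ahead_irr.
rewrite !departureE /departure_step {1}/arrival {1}/service ej.
congr (Num.max _ _ + _); apply: eq_big => // i ij.
by apply: IH => //; [exact: ahead_trans jk|apply: ahead_trans jk'; rewrite -aheadE].
Qed.

End paths.

Section measurability.
Context d (T : measurableType d) (R : realType) (n : nat) (s : 'S_n).
Variable W : T -> n.-tuple (R * R).
Hypothesis mW : measurable_fun setT W.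

Lemma measurable_arrival j : measurable_fun setT (fun x => arrival (W x) j).
Proof.
apply: measurableT_comp => //.
exact: measurableT_comp (measurable_tnth _) mW.
Qed.

Lemma measurable_service j : measurable_fun setT (fun x => service (W x) j).
Proof.
apply: measurableT_comp => //.
exact: measurableT_comp (measurable_tnth _) mW.
Qed.

Lemma measurable_ahead i j : measurable_fun setT (fun x => ahead s (W x) i j).
Proof.
rewrite /ahead; apply: measurable_or.
  by apply: measurable_fun_ltr; exact: measurable_arrival.
apply: measurable_and; last exact: measurable_cst.
by apply: measurable_fun_eqr; exact: measurable_arrival.
Qed.

Lemma measurable_departure j : measurable_fun setT (fun x => departure s (W x) j).
Proof.
rewrite /departure; move: j.
suff : forall m j, measurable_fun setT
    (fun x => iter m (departure_step s (W x)) (fun=> 0) j) by exact.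
elim=> [|m IH] j /=; first exact: measurable_cst.
rewrite [X in measurable_fun _ X](_ : _ = fun x => Num.max (arrival (W x) j)
  (\big[Num.max/0]_(i | ahead s (W x) i j)
     iter m (departure_step s (W x)) (fun=> 0) i) + service (W x) j)//.
apply: measurable_funD; last exact: measurable_service.
apply: measurable_maxr; first exact: measurable_arrival.
elim: (index_enum _) => [|i r IHr]; last first.
  under eq_fun do rewrite big_cons.
  apply: measurable_fun_ifT => //; first exact: measurable_ahead.
  exact: measurable_maxr (IH i) IHr.
under eq_fun do rewrite big_nil.
exact: measurable_cst.
Qed.

End measurability.

(** * Independent draws *)

Section iid_theory.
Context d (T : measurableType d) (R : realType) (P : probability T R).

Lemma tnth_tcons0 n (p : T * n.-tuple T) : tnth (tcons p) ord0 = p.1.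
Proof. by []. Qed.

Lemma tnth_tconsS n (p : T * n.-tuple T) (i : 'I_n) :
  tnth (tcons p) (lift ord0 i) = tnth p.2 i.
Proof. by rewrite tnthS; congr tnth; exact: val_inj. Qed.

Lemma integral_iid0 (f : 0.-tuple T -> \bar R) : measurable_fun setT f ->
  (\int[iid P 0]_w f w = f [tuple of [::]])%E.
Proof. by move=> mf; rewrite /= integral_dirac// diracT mul1e. Qed.

Lemma integral_iidS n (f : n.+1.-tuple T -> \bar R) :
  measurable_fun setT f -> (forall w, 0 <= f w)%E ->
  (\int[iid P n.+1]_w f w = \int[P]_x \int[iid P n]_w f (tcons (x, w)))%E.
Proof.
move=> mf f0; rewrite /= ge0_integral_distribution//.
rewrite fubini_tonelli1//=.
exact: measurableT_comp mf (@measurable_tcons _ _ _).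
Qed.

Lemma iidSE n (E : set (n.+1.-tuple T)) : measurable E ->
  (iid P n.+1 E = \int[P]_x iid P n [set w | E (tcons (x, w))])%E.
Proof.
move=> mE; transitivity (\int[iid P n.+1]_w (\1_E w)%:E)%E.
  by rewrite integral_indic// setIT.
rewrite integral_iidS; [|by apply/measurable_EFinP|by move=> w; rewrite lee_fin].
apply: eq_integral => x _.
transitivity (\int[iid P n]_w (\1_[set w | E (tcons (x, w))] w)%:E)%E; first by [].
rewrite integral_indic ?setIT//.
rewrite -[X in measurable X]setTI.
by have := measurableT_comp (@measurable_tcons _ T n) (pair1_measurable x); apply.
Qed.

(** The opposite order of integration to [iidSE]: the later draws are frozen and the first one stays
    random, so that an atomless law can make the inner probability vanish. *)
Lemma iidSE' n (E : set (n.+1.-tuple T)) : measurable E ->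
  (iid P n.+1 E = \int[iid P n]_w P [set x | E (tcons (x, w))])%E.
Proof.
move=> mE; transitivity (\int[iid P n.+1]_w (\1_E w)%:E)%E.
  by rewrite integral_indic// setIT.
rewrite integral_iidS; [|by apply/measurable_EFinP|by move=> w; rewrite lee_fin].
rewrite (fubini_tonelli (fun p => (\1_E (tcons p) : R)%:E)); last 2 first.
- apply/measurable_EFinP.
  by apply: (measurableT_comp _ (@measurable_tcons _ T n)).
- by move=> p; rewrite lee_fin.
apply: eq_integral => w _.
transitivity (\int[P]_x (\1_[set x | E (tcons (x, w))] x)%:E)%E; first by [].
rewrite integral_indic ?setIT//.
rewrite -[X in measurable X]setTI.
by have := measurableT_comp (@measurable_tcons _ T n) (pair2_measurable w); apply.
Qed.

Lemma iidS_setX n (A : set T) (E : set (n.-tuple T)) (F : set (n.+1.-tuple T)) :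
  measurable A -> measurable E ->
  (forall x w, F (tcons (x, w)) <-> A x /\ E w) ->
  (iid P n.+1 F = P A * iid P n E)%E.
Proof.
move=> mA mE FE; rewrite /= /distribution /pushforward.
rewrite -product_measure1E//; congr (_ _).
by apply/seteqP; split => -[x w] /= /FE.
Qed.

Lemma iid_tnth n (i : 'I_n) (A : set T) : measurable A ->
  iid P n [set w | A (tnth w i)] = P A.
Proof.
move=> mA; elim: n i => [[]//|n IH] i.
have mtnth m (j : 'I_m) : measurable [set w | A (tnth w j)].
  by rewrite -[X in measurable X]setTI; exact: measurable_tnth.
have [j ->|->] := unliftP ord0 i.
  rewrite (@iidS_setX _ setT [set w | A (tnth w j)]) ?IH ?probability_setT ?mul1e//.
  by move=> x w /=; rewrite tnth_tconsS/=; split=> [|[]].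
rewrite (@iidS_setX _ A setT) ?probability_setT ?mule1//.
by move=> x w /=; rewrite tnth_tcons0/=; split=> [|[]].
Qed.

Lemma measurable_forall_tnth n (A : set T) : measurable A ->
  measurable [set w : n.-tuple T | forall i, A (tnth w i)].
Proof.
move=> mA; rewrite (_ : mkset _ = \bigcap_(i in [set: 'I_n]) [set w | A (tnth w i)]).
  apply: fin_bigcap_measurable => // i _.
  by rewrite -[X in measurable X]setTI; exact: measurable_tnth.
by apply/seteqP; split => [w wA i _|w wA i]; [exact: wA|exact: (wA i)].
Qed.

Lemma iid_forall_tnth n (A : set T) : measurable A ->
  iid P n [set w | forall i, A (tnth w i)] = (P A ^+ n)%E.
Proof.
move=> mA; elim: n => [|n IH].
  rewrite (_ : mkset _ = setT) ?probability_setT//.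
  by apply/seteqP; split => // w _ [].
rewrite (@iidS_setX _ A [set w | forall i, A (tnth w i)])//.
- by rewrite IH expeS.
- exact: measurable_forall_tnth.
move=> x w /=; split=> [wA|[Ax wA] i].
  split=> [|i]; first by have := wA ord0; rewrite tnth_tcons0.
  by have := wA (lift ord0 i); rewrite tnth_tconsS.
by have [j ->|->] := unliftP ord0 i; rewrite ?tnth_tconsS ?tnth_tcons0.
Qed.

End iid_theory.

Section separation.
Context d1 d2 (T1 : measurableType d1) (T2 : measurableType d2) (R : realType).
Context (P : probability T1 R) (Q : probability T2 R).

Definition tzip n (p : n.-tuple T1 * n.-tuple T2) : n.-tuple (T1 * T2) :=
  [tuple (tnth p.1 i, tnth p.2 i) | i < n].

Lemma measurable_tzip n : measurable_fun setT (@tzip n).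
Proof.
apply/measurable_fun_tnthP => i.
rewrite (_ : _ \o _ = fun p => (tnth p.1 i, tnth p.2 i)).
  apply/measurable_fun_pairP; split.
    exact: measurableT_comp (measurable_tnth i) _.
  exact: measurableT_comp (measurable_tnth i) _.
by apply/funext => p /=; rewrite tnth_mktuple.
Qed.

Lemma tzip_tcons n x y (a : n.-tuple T1) (b : n.-tuple T2) :
  tzip (tcons (x, a), tcons (y, b)) = tcons ((x, y), tzip (a, b)).
Proof.
apply: eq_from_tnth => i; rewrite tnth_mktuple.
have [j ->|->] := unliftP ord0 i; last by rewrite !tnth_tcons0.
by rewrite !tnth_tconsS/= tnth_mktuple.
Qed.

(** Independent pairs amount to two independent tuples. This allows all arrival times, hence the
    order of service, to be frozen while the services are integrated. *)
Lemma integral_iid_prod n (f : n.-tuple (T1 * T2) -> \bar R) :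
  measurable_fun setT f -> (forall w, 0 <= f w)%E ->
  (\int[iid (P \x Q) n]_w f w =
   \int[iid P n]_a \int[iid Q n]_b f (tzip (a, b)))%E.
Proof.
elim: n f => [|n IH] f mf f0.
  have mg : measurable_fun setT (f \o @tzip 0).
    exact: measurableT_comp mf (@measurable_tzip _).
  rewrite !integral_iid0//.
  - by congr f; apply: eq_from_tnth => -[].
  - exact: (@measurable_fun_pair2 _ _ _ _ _ _ (f \o @tzip 0) _ mg).
  - by apply: (measurable_fun_fubini_tonelli_F (f \o @tzip 0)) => // w; exact: f0.
have mcons d (T : measurableType d) m (x : T) :
    measurable_fun setT (fun w : m.-tuple T => tcons (x, w)).
  exact: measurableT_comp (@measurable_tcons _ _ _) (pair1_measurable _).
pose F x y := (\int[iid P n]_a \int[iid Q n]_b f (tcons ((x, y), tzip (a, b))))%E.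
transitivity (\int[P]_x \int[Q]_y F x y)%E.
  rewrite (integral_iidS _ mf f0) (fubini_tonelli1
    (fun p => \int[iid (P \x Q) n]_w f (tcons (p, w)))%E).
  - apply: eq_integral => x _; apply: eq_integral => y _.
    rewrite IH; [by []| |by move=> w; exact: f0].
    exact: measurableT_comp mf (mcons _ _ _ _).
  - apply: (measurable_fun_fubini_tonelli_F (f \o @tcons _ _ n)) => [|w].
      exact: measurableT_comp mf (@measurable_tcons _ _ _).
    exact: f0.
  - by move=> xy; apply: integral_ge0 => w _; exact: f0.
have mg : measurable_fun setT (f \o @tzip n.+1).
  exact: measurableT_comp mf (@measurable_tzip _).
rewrite integral_iidS; last 2 first.
- by apply: (measurable_fun_fubini_tonelli_F (f \o @tzip n.+1)) => // w; exact: f0.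
- by move=> a; apply: integral_ge0 => b _; exact: f0.
apply: eq_integral => x _.
(* Grouping the new service [y] with the earlier arrivals [a] puts the integrals in the form where
   Tonelli exchanges these two. *)
pose g (yab : (T2 * n.-tuple T1) * n.-tuple T2) :=
  f (tcons ((x, yab.1.1), tzip (yab.1.2, yab.2))).
have mgg : measurable_fun setT g.
  apply: (measurableT_comp mf); apply: measurable_cons => /=.
    apply: measurable_fun_pair; first exact: measurable_cst.
    exact: (measurableT_comp measurable_fst measurable_fst).
  apply: (measurableT_comp (@measurable_tzip _)); apply: measurable_fun_pair => //.
  exact: (measurableT_comp measurable_snd measurable_fst).
rewrite /F (fubini_tonelli (fun p => \int[iid Q n]_b g (p, b))%E); last 2 first.
- by apply: (measurable_fun_fubini_tonelli_F g) => // w; exact: f0.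
- by move=> p; apply: integral_ge0 => b _; exact: f0.
apply: eq_integral => a _; rewrite integral_iidS; last 2 first.
- exact: (@measurable_fun_pair2 _ _ _ _ _ _ (f \o @tzip n.+1) _ mg).
- by move=> b; exact: f0.
apply: eq_integral => y _; apply: eq_integral => b _.
by rewrite /g tzip_tcons.
Qed.

Lemma measurable_iid_section n (E : set (n.-tuple (T1 * T2))) : measurable E ->
  measurable_fun setT (fun a => iid Q n [set b | E (tzip (a, b))]).
Proof.
move=> mE; have mE' : measurable (@tzip n @^-1` E).
  by rewrite -[X in measurable X]setTI; exact: measurable_tzip.
have := measurable_fun_xsection (iid Q n) mE'.
apply: eq_measurable_fun => a _; congr (iid Q n _); apply/seteqP.
by split=> b; rewrite /xsection/= inE.
Qed.

Lemma iid_prodE n (E : set (n.-tuple (T1 * T2))) : measurable E ->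
  (iid (P \x Q) n E = \int[iid P n]_a iid Q n [set b | E (tzip (a, b))])%E.
Proof.
move=> mE; rewrite -[in LHS](setIT E) -integral_indic//.
rewrite integral_iid_prod//; last by apply/measurable_EFinP.
apply: eq_integral => a _.
rewrite -[X in iid Q n X]setIT -integral_indic//.
rewrite -[X in measurable X]setTI.
have := measurableT_comp (@measurable_tzip n) (pair1_measurable a).
by apply.
Qed.

End separation.

(** * Exponential service times *)

Section exponential.
Context (R : realType) (mu : R) (mu_gt0 : 0 < mu).
Local Notation S := (service_law mu_gt0).
Local Notation leb := (@lebesgue_measure R).

Lemma service_lawE A : S A = (\int[leb]_(x in A) (exponential_pdf mu x)%:E)%E.
Proof. by []. Qed.

Lemma service_law_set1 x : S [set x] = 0%E.
Proof. by rewrite service_lawE integral_set1. Qed.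

Lemma service_law_lt0 : S `]-oo, 0[%classic = 0%E.
Proof.
rewrite service_lawE integral0_eq// => x; rewrite /= in_itv/= => x0.
by rewrite lt0_exponential_pdf.
Qed.

Lemma service_law_gt (y : R) : 0 <= y -> S `]y, +oo[%classic = (expR (- (mu * y)))%:E.
Proof.
have gt0 (z : R) : 0 < z -> S `]z, +oo[%classic = (expR (- (mu * z)))%:E.
  move=> z0.
  have : S (~` `]z, +oo[%classic) = (1 - (expR (- (mu * z)))%:E)%E.
    rewrite setCitvr.
    have -> : `]-oo, z]%classic = `]-oo, 0[%classic `|` `[0, z]%classic :> set R.
      by rewrite -itv_bndbnd_setU// bnd_simp ltW.
    have -> : S ((`]-oo, 0[%classic : set R) `|` `[0, z]%classic) =
        (S `]-oo, 0%R[%classic + S `[0%R, z]%classic)%E.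
      apply: measureU => //.
      apply/seteqP; split => x //=; rewrite !in_itv/= => -[x0 /andP[]].
      by rewrite leNgt x0.
    rewrite service_law_lt0 add0e.
    by have := exponential_prob_itv0c mu z0; rewrite mulNr.
  rewrite probability_setC// => h.
  have : S `]z, +oo[%classic \is a fin_num by exact: fin_num_measure.
  case: (S _) h => // r; rewrite -!EFinB => -[h] _; congr EFin; lra.
rewrite le_eqVlt => /orP[/eqP <-|]; last exact: gt0.
rewrite mulr0 oppr0 expR0.
have : S (~` `]0, +oo[%classic) = 0%E.
  rewrite setCitvr.
  have -> : `]-oo, 0]%classic = `]-oo, 0[%classic `|` [set 0] :> set R.
    by rewrite setUitv1.
  have -> : S ((`]-oo, 0[%classic : set R) `|` [set 0]) =
      (S `]-oo, 0%R[%classic + S [set 0%R])%E.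
    apply: measureU => //; apply/seteqP; split => x //=; rewrite !in_itv/=.
    by move=> -[] /[swap] ->; rewrite ltxx.
  by rewrite service_law_lt0 service_law_set1 adde0.
rewrite probability_setC// => h.
have : S `]0, +oo[%classic \is a fin_num by exact: fin_num_measure.
case: (S _) h => // r; rewrite -!EFinB => -[h] _; congr EFin; lra.
Qed.

Lemma service_law_itv (u v : R) : 0 <= u -> u < v ->
  S `]u, v]%classic = (expR (- (mu * u)) - expR (- (mu * v)))%:E.
Proof.
move=> u0 uv; have v0 := le_trans u0 (ltW uv).
have : S ((`]u, v]%classic : set R) `|` `]v, +oo[%classic) =
    (S `]u, v]%classic + S `]v, +oo[%classic)%E.
  apply: measureU => //; apply/seteqP; split => x //=.
  by rewrite !in_itv/= andbT => -[/andP[_ xv]]; rewrite ltNge xv.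
rewrite -itv_bndbnd_setU ?bnd_simp ?(ltW uv)//.
rewrite !service_law_gt// EFinB => ->.
by rewrite addeK.
Qed.

Lemma service_law_itv_gt0 (u v : R) : 0 <= u -> u < v ->
  (0 < S `]u, v]%classic)%E.
Proof.
move=> u0 uv; rewrite service_law_itv// lte_fin subr_gt0.
by rewrite ltr_expR ltrN2 ltr_pM2l.
Qed.

(* Layer cake: phi x is the Lebesgue measure of [0, phi x[, so the formula for
   indicators, which defines the exponential law, gives it for phi by Tonelli. *)
Lemma integral_service_law (phi : R -> R) :
  measurable_fun setT phi -> (forall x, 0 <= phi x) ->
  (\int[S]_x (phi x)%:E =
   \int[leb]_x ((phi x)%:E * (exponential_pdf mu x)%:E))%E.
Proof.
move=> mphi phi0.
pose E : set (measurableTypeR R * measurableTypeR R) :=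
  [set p | 0 <= p.2 < phi p.1].
have mE : measurable E.
  rewrite -[X in measurable X]setTI.
  have mf : measurable_fun setT
      (fun p : measurableTypeR R * measurableTypeR R => 0 <= p.2 < phi p.1).
    apply: measurable_and; first exact: measurable_fun_ler.
    by apply: measurable_fun_ltr => //; exact: measurableT_comp.
  by apply: (mf measurableT [set true]).
pose f p := (\1_E p : R)%:E.
have mf : measurable_fun setT f by apply/measurable_EFinP.
have f0 p : (0 <= f p)%E by rewrite lee_fin.
have slice x : (phi x)%:E = (\int[leb]_u f (x, u))%E.
  rewrite (_ : (fun u => f (x, u)) = fun u => (\1_(`[0, phi x[) u)%:E); last first.
    apply/funext => u; rewrite /f !indicE.
    suff -> : ((x, u) \in E) = (u \in `[0, phi x[%classic) by [].
    by apply/idP/idP; rewrite !inE /E/= ?in_itv.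
  have -> : (phi x)%:E = leb `[0, phi x[%classic.
    rewrite lebesgue_measure_itv/= lte_fin.
    by case: ltgtP (phi0 x) => // [x0 _|<- _]; rewrite ?oppr0 ?adde0.
  by rewrite integral_indic// setIT.
transitivity (\int[S]_x \int[leb]_u f (x, u))%E.
  by apply: eq_integral => x _; rewrite slice.
rewrite (fubini_tonelli f)//.
transitivity (\int[leb]_u \int[leb]_x (f (x, u) * (exponential_pdf mu x)%:E))%E.
  apply: eq_integral => u _.
  pose B := [set x : R | 0 <= u < phi x].
  have mB : measurable B.
    rewrite -[X in measurable X]setTI.
    apply: (measurable_and (f := fun=> 0 <= u) (g := fun x => u < phi x)
      _ _ measurableT (Y := [set true])) => //.
    exact: measurable_fun_ltr.
  have fB x : f (x, u) = (\1_B x)%:E.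
    rewrite /f !indicE; suff -> : ((x, u) \in E) = (x \in B) by [].
    by apply/idP/idP; rewrite !inE.
  under eq_integral do rewrite fB.
  under [in RHS]eq_integral do rewrite fB.
  transitivity (S B); first by rewrite integral_indic// setIT.
  rewrite service_lawE.
  rewrite [LHS]integral_mkcond; apply: eq_integral => x _.
  rewrite patchE indicE; case: (x \in B); first by rewrite mul1e.
  by rewrite mul0e.
rewrite -(fubini_tonelli (fun p => f p * (exponential_pdf mu p.1)%:E)%E); last 2 first.
- apply: emeasurable_funM => //; apply/measurable_EFinP.
  exact: measurableT_comp (measurable_exponential_pdf _) _.
- by move=> p; rewrite mule_ge0// lee_fin exponential_pdf_ge0// ltW.
apply: eq_integral => x _; rewrite slice.
transitivity (\int[leb]_u (f (x, u) * (exponential_pdf mu x)%:E))%E; first by [].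
apply: (@ge0_integralZr _ _ _ leb _ measurableT (fun u => f (x, u))) => //.
- exact: (@measurable_fun_pair2 _ _ _ _ _ _ f x mf).
- by rewrite lee_fin exponential_pdf_ge0// ltW.
Qed.

(* The tail of the Erlang distribution: the probability that fewer than k events
   of a Poisson process of rate mu occur before time y. *)
Definition erlang_tail (k : nat) (y : R) : R :=
  if 0 <= y then \sum_(i < k) expR (- (mu * y)) * (mu * y) ^+ i / i`!%:R else 1.

Lemma erlang_tail_ge0 k y : 0 <= erlang_tail k y.
Proof.
rewrite /erlang_tail; case: ifP => // y0; apply: sumr_ge0 => i _.
by rewrite !mulr_ge0// ?expR_ge0// ?exprn_ge0 ?mulr_ge0// ?invr_ge0// ltW.
Qed.

Lemma measurable_erlang_tail k : measurable_fun setT (erlang_tail k).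
Proof.
rewrite /erlang_tail; apply: measurable_fun_ifT => //.
  exact: measurable_fun_ler.
apply: measurable_sum => i; apply: measurable_funM => //.
have mM : measurable_fun setT (fun y : R => mu * y) by exact: measurable_funM.
apply: measurable_funM; last exact: measurable_funX.
by apply: measurableT_comp => //; exact: measurableT_comp.
Qed.

Lemma integral_polynomial_FTC (p : {poly R}) (y : R) : 0 <= y ->
  (\int[leb]_(x in `[0%R, y]) (p^`().[x])%:E = (p.[y])%:E - (p.[0])%:E)%E.
Proof.
rewrite le_eqVlt => /orP[/eqP <-|y0].
  by rewrite set_itv1 integral_set1 subee.
apply: (@continuous_FTC2 R (horner p^`()) (horner p)) => //.
- by apply: continuous_subspaceT; exact: continuous_horner.
- split; first by move=> z _; exact: derivable_horner.
    by apply: cvg_at_right_filter; exact: continuous_horner.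
  by apply: cvg_at_left_filter; exact: continuous_horner.
- by move=> z _; rewrite derivE.
Qed.

(* Conditioning on the first of the k + 1 summands. *)
Lemma integral_erlang_tail k y :
  (\int[S]_x (erlang_tail k (y - x))%:E = (erlang_tail k.+1 y)%:E)%E.
Proof.
have mB : measurable_fun setT (fun x : R => erlang_tail k (y - x)).
  apply: measurableT_comp; first exact: measurable_erlang_tail.
  exact: measurable_funB.
rewrite integral_service_law//; last by move=> x; exact: erlang_tail_ge0.
have pdf_lt0 x : x < 0 -> exponential_pdf mu x = 0 by exact: lt0_exponential_pdf.
have [y0|y0] := ltP y 0.
  rewrite {2}/erlang_tail leNgt y0/= -(integral_exponential_pdf mu_gt0).
  apply: eq_integral => x _; have [/pdf_lt0->|x0] := ltP x 0; first by rewrite mule0.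
  rewrite /erlang_tail ifF ?mul1e//.
  by apply/negbTE; rewrite -ltNge subr_lt0 (lt_le_trans y0).
(* On [[0, y]] the two exponentials multiply to the constant [c], so the integrand is a polynomial
   in [x], with antiderivative [q]. Beyond [y] the tail equals 1, and the density alone integrates
   to [c], the term of index 0 in the new sum. *)
pose c := expR (- (mu * y)).
pose l : {poly R} := mu *: (y%:P - 'X).
pose q : {poly R} := - c *: \sum_(i < k) (i.+1`!%:R^-1 *: l ^+ i.+1).
have lE x : l.[x] = mu * (y - x) by rewrite !hornerE.
have q'E x : q^`().[x] = c * mu * \sum_(i < k) (mu * (y - x)) ^+ i / i`!%:R.
  rewrite derivZ hornerZ linear_sum/= horner_sum mulNr -mulrN -mulrA.
  congr (_ * _); rewrite mulr_sumr -sumrN; apply: eq_bigr => i _.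
  rewrite derivZ hornerZ deriv_exp /l derivZ derivB derivC derivX sub0r.
  rewrite hornerMn hornerM hornerZ hornerN hornerC -/l horner_exp lE -mulr_natr /=.
  have i0 : i.+1%:R != 0 :> R by rewrite pnatr_eq0.
  have i1 : i`!%:R != 0 :> R by rewrite pnatr_eq0 -lt0n fact_gt0.
  by rewrite factS natrM; field; rewrite i1/= nat1r.
have qE : erlang_tail k.+1 y = c + (q.[y] - q.[0]).
  rewrite /erlang_tail y0 big_ord_recl/= !expr0 fact0 divr1 mulr1; congr (_ + _).
  rewrite /q !hornerZ !horner_sum -mulrBr -sumrB [RHS]mulr_sumr; apply: eq_bigr => j _.
  rewrite !hornerZ !horner_exp !lE subr0 subrr mulr0 expr0n/= mulr0 sub0r.
  rewrite mulrNN /bump/= add1n -mulrA; congr (_ * _).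
  by rewrite mulrC.
have q'_ge0 x : 0 <= ((horner q^`()) \_ `[0, y]) x.
  rewrite patchE; case: ifPn => // /set_mem/=; rewrite in_itv/= => /andP[x0 xy].
  rewrite q'E mulr_ge0 ?mulr_ge0 ?expR_ge0 ?(ltW mu_gt0)//.
  apply: sumr_ge0 => i _; rewrite divr_ge0// exprn_ge0//.
  by rewrite mulr_ge0 ?subr_ge0// ltW.
have pdf_ge0 x : 0 <= (exponential_pdf mu \_ `]y, +oo[) x.
  by rewrite patchE; case: ifPn => // _; exact/exponential_pdf_ge0/ltW.
have mq : measurable_fun setT (horner q^`()).
  by apply: continuous_measurable_fun; exact: continuous_horner.
transitivity (\int[leb]_x (((exponential_pdf mu \_ `]y, +oo[) x)%:E +
    ((horner q^`() \_ `[0%R, y]) x)%:E))%E.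
  apply: eq_integral => x _; rewrite !patchE -EFinM -EFinD; congr EFin.
  have [x0|x0] := ltP x 0.
    rewrite pdf_lt0// mulr0 !ifF ?addr0//; apply/negbTE/negP => /set_mem/=.
      by rewrite in_itv/= leNgt x0.
    by rewrite in_itv/= andbT ltNge (le_trans (ltW x0)).
  have [xy|xy] := leP x y.
    rewrite ifF ?ifT ?add0r//.
    - rewrite q'E /erlang_tail subr_ge0 xy exponential_pdfE// mulr_suml mulr_sumr.
      apply: eq_bigr => i _.
      have -> : c = expR (- (mu * (y - x))) * expR (- mu * x).
        by rewrite -expRD; congr expR; ring.
      ring.
    - by apply/mem_set; rewrite /= in_itv/= x0.
    - by apply/negbTE/negP => /set_mem/=; rewrite in_itv/= andbT ltNge xy.
  rewrite ifT ?ifF ?addr0//.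
  - by rewrite /erlang_tail subr_ge0 leNgt xy mul1r.
  - by apply/negbTE/negP => /set_mem/=; rewrite in_itv/= x0/= leNgt xy.
  - by apply/mem_set; rewrite /= in_itv/= xy.
rewrite ge0_integralD//; last 4 first.
- by move=> x _; rewrite lee_fin.
- apply/measurable_EFinP/(measurable_restrict _ _ _) => //.
  by apply: measurable_funTS; exact: measurable_exponential_pdf.
- by move=> x _; rewrite lee_fin.
- apply/measurable_EFinP/(measurable_restrict _ _ _) => //.
  exact: measurable_funTS.
rewrite qE EFinD; congr (_ + _)%E.
  rewrite /c -service_law_gt// service_lawE [RHS]integral_mkcond.
  by apply: eq_integral => x _; rewrite !patchE; case: ifP.
rewrite EFinB -integral_polynomial_FTC// [RHS]integral_mkcond.
by apply: eq_integral => x _; rewrite !patchE; case: ifP.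
Qed.

Let tail_set n (B : {set 'I_n.+1}) := [set j | lift ord0 j \in B]%SET.

Lemma sum_tcons n (B : {set 'I_n.+1}) (x : R) (b : n.-tuple R) :
  \sum_(i in B) tnth (tcons (x, b)) i =
  (if ord0 \in B then x else 0) + \sum_(j in tail_set B) tnth b j.
Proof.
rewrite big_mkcond big_ord_recl [X in _ = _ + X]big_mkcond; congr (_ + _).
by apply: eq_bigr => j _; rewrite tnth_tconsS inE.
Qed.

Lemma card_tail_set n (B : {set 'I_n.+1}) :
  #|B| = ((ord0 \in B) + #|tail_set B|)%N.
Proof.
rewrite -!sum1_card big_mkcond big_ord_recl [X in _ = (_ + X)%N]big_mkcond.
congr (_ + _)%N.
by apply: eq_bigr => j _; rewrite inE.
Qed.

Lemma measurable_service_sum n (B : {set 'I_n}) :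
  measurable_fun setT (fun b : n.-tuple (measurableTypeR R) =>
    \sum_(i in B) tnth b i).
Proof.
under eq_fun do rewrite big_mkcond.
apply: measurable_sum => i; case: (i \in B) => //; exact: measurable_tnth.
Qed.

(** With the other services frozen, a member of [B] would have to take one prescribed value, which
    is a null event. An empty [B] must be excluded, since its sum is not random. *)
Lemma iid_service_sum_eq n (B : {set 'I_n}) i0 y : i0 \in B ->
  iid S n [set b | \sum_(i in B) tnth b i = y] = 0%E.
Proof.
elim: n B i0 => [B []//|n IH] B i0 i0B.
have mE m (C : {set 'I_m}) : measurable
    [set b : m.-tuple (measurableTypeR R) | \sum_(i in C) tnth b i = y].
  rewrite -[X in measurable X]setTI.
  exact: (measurable_service_sum C measurableT (measurable_set1 y)).
have [B0|B0] := boolP (ord0 \in B); last first.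
  rewrite (@iidS_setX _ _ _ S n setT [set b : n.-tuple (measurableTypeR R) |
      \sum_(i in tail_set B) tnth b i = y])//.
    have [j jE|] := unliftP ord0 i0; last by move=> i00; rewrite -i00 i0B in B0.
    by rewrite (IH _ j) ?mule0// inE -jE.
  move=> x b; rewrite /mkset sum_tcons (negbTE B0) add0r.
  by split=> [|[]].
rewrite iidSE'//; apply: integral0_eq => b _.
rewrite -(service_law_set1 (y - \sum_(j in tail_set B) tnth b j)); congr (S _).
apply/seteqP; split => x /=; rewrite sum_tcons B0 => h; first by rewrite -h addrK.
by rewrite h subrK.
Qed.

(** Each index in [B] contributes one convolution step [integral_erlang_tail], and the other indices
    integrate out, so only the size of [B] matters. Conditioning moves the level to [y - x],
    possibly negative; hence the quantification over all [y] and the value 1 of [erlang_tail]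
    there. *)
Lemma iid_service_sum_gt n (B : {set 'I_n}) y :
  iid S n [set b | y < \sum_(i in B) tnth b i] = (erlang_tail #|B| y)%:E.
Proof.
have mE m (C : {set 'I_m}) z : measurable
    [set b : m.-tuple (measurableTypeR R) | z < \sum_(i in C) tnth b i].
  rewrite -[X in measurable X]setTI.
  apply: (measurable_fun_ltr _ (measurable_service_sum C)
    measurableT (Y := [set true])) => //.
elim: n B y => [|n IH] B y.
  have -> : #|B| = 0%N by apply: eq_card0 => -[].
  rewrite /= diracE; congr EFin; rewrite /erlang_tail big_ord0.
  suff -> : ([tuple] \in [set b : 0.-tuple R | y < \sum_(i in B) tnth b i]) = (y < 0).
    by rewrite ltNge; case: (0 <= y).
  by apply/idP/idP; rewrite inE/= big1// => -[].
have [B0|B0] := boolP (ord0 \in B); last first.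
  rewrite (@iidS_setX _ _ _ S n setT [set b : n.-tuple (measurableTypeR R) |
      y < \sum_(i in tail_set B) tnth b i])//.
    by rewrite probability_setT mul1e IH card_tail_set (negbTE B0).
  move=> x b; rewrite /mkset sum_tcons (negbTE B0) add0r.
  by split=> [|[]].
rewrite iidSE// card_tail_set B0 add1n -integral_erlang_tail.
apply: eq_integral => x _; rewrite -IH; congr (iid S n _).
by apply/seteqP; split => b /=; rewrite sum_tcons B0 ltrBlDl.
Qed.

End exponential.

(** * Expected queue length and expected number of predecessors *)

Section real_probability.
Context d (T : measurableType d) (R : realType) (P : probability T R).
Implicit Types A B Z : set T.

Lemma fine_probability_ge0 A : 0 <= fine (P A).
Proof. exact: fine_ge0. Qed.

Lemma fine_probabilityE A : measurable A -> P A = (fine (P A))%:E.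
Proof. by move=> mA; rewrite fineK// fin_num_measure. Qed.

Lemma le_fine_probability A B : measurable A -> measurable B -> A `<=` B ->
  fine (P A) <= fine (P B).
Proof.
move=> mA mB AB; rewrite fine_le ?fin_num_measure//.
by apply: le_measure; rewrite ?inE.
Qed.

Lemma fine_probabilityU A B : measurable A -> measurable B ->
  [disjoint A & B] -> fine (P (A `|` B)) = fine (P A) + fine (P B).
Proof.
move=> mA mB /disj_set2P AB; rewrite measureU// fineD// fin_num_measure//.
Qed.

Lemma le_fine_probability_null A B Z : measurable A -> measurable B ->
  measurable Z -> P Z = 0%E -> A `<=` B `|` Z -> fine (P A) <= fine (P B).
Proof.
move=> mA mB mZ Z0 ABZ; apply: (@le_trans _ _ (fine (P (B `|` Z)))).
  by apply: le_fine_probability => //; exact: measurableU.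
rewrite fine_le ?fin_num_measure//; first exact: measurableU.
by apply: le_trans (measureU2 _ mB mZ) _; rewrite [X in (_ + X)%E]Z0 adde0.
Qed.

End real_probability.

(** Composition with the transposition of [i] and [j] exchanges the two orders, and each permutation
    realises exactly one of them. Hence the factor one half on every atom. *)
Lemma sum_perm_lt (R : realType) n (i j : 'I_n) : i != j ->
  \sum_(s : 'S_n) (s i < s j)%N%:R = n`!%:R / 2 :> R.
Proof.
move=> ij; pose f (x y : 'I_n) := \sum_(s : 'S_n) (s x < s y)%N%:R : R.
have sym : f i j = f j i.
  rewrite /f (reindex_inj (mulgI (tperm i j))); apply: eq_bigr => s _.
  by rewrite !permM tpermL tpermR.
have tot : f i j + f j i = n`!%:R.
  rewrite -card_Sn -sum1_card natr_sum -big_split.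
  apply: eq_big => // s _.
  have : s i != s j :> nat by rewrite (inj_eq val_inj) (inj_eq perm_inj).
  by case: (ltngtP (s i) (s j)) => //= _ _; rewrite ?addr0 ?add0r.
rewrite -/(f i j) -tot -sym; lra.
Qed.

Lemma fine_law_itvNyc (R : realType) (F : cumulativeBounded (0 : R) (1 : R)) (x : R) :
  fine (law F `]-oo, x]%classic) = fine (law F `]-oo, x[%classic) + atom F x.
Proof.
rewrite /atom -fine_probabilityU//.
  by congr fine; congr (law F _); rewrite setUitv1.
apply/disj_set2P/seteqP; split => z //= [].
by rewrite in_itv/= => /[swap] ->; rewrite ltxx.
Qed.

Section mean.
Context (R : realType) (N : nat) (mu : R) (mu_gt0 : 0 < mu).
Context (F : cumulativeBounded (0 : R) (1 : R)).
Local Notation S := (service_law mu_gt0).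
Local Notation L := (others_law N mu_gt0 F).
Local Notation MR := (measurableTypeR R).
Implicit Types (t u x : R) (w : N.-tuple (R * R)) (s : 'S_N.+1) (i : 'I_N).

Definition with_self t w : N.+1.-tuple (R * R) := [tuple of (t, 0) :: w].

Lemma tnth_with_self t w i : tnth (with_self t w) (lift ord0 i) = tnth w i.
Proof. by rewrite tnthS; congr tnth; exact: val_inj. Qed.

Lemma measurable_with_self t :
  measurable_fun setT (with_self t : N.-tuple (MR * MR) -> N.+1.-tuple (MR * MR)).
Proof. exact: measurableT_comp (@measurable_tcons _ _ _) (pair1_measurable _). Qed.

Lemma arrival_self t w : arrival (with_self t w) ord0 = t.
Proof. by []. Qed.

Lemma service_self t w : service (with_self t w) ord0 = 0.
Proof. by []. Qed.

Lemma arrival_other t w i : arrival (with_self t w) (lift ord0 i) = (tnth w i).1.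
Proof. by rewrite /arrival tnth_with_self. Qed.

Lemma service_other t w i : service (with_self t w) (lift ord0 i) = (tnth w i).2.
Proof. by rewrite /service tnth_with_self. Qed.

Definition other_ahead s t i w : bool := ahead s (with_self t w) (lift ord0 i) ord0.

Definition other_departure s t i w : R := departure s (with_self t w) (lift ord0 i).

Lemma other_aheadE s t i w : other_ahead s t i w =
  ((tnth w i).1 < t) || ((tnth w i).1 == t) && (s (lift ord0 i) < s ord0)%N.
Proof. by rewrite /other_ahead /ahead arrival_other. Qed.

Lemma measurable_other_ahead s t i :
  measurable_fun setT (other_ahead s t i : N.-tuple (MR * MR) -> bool).
Proof. exact: measurable_ahead (measurable_with_self t) _ _. Qed.

Lemma measurable_other_departure s t i :
  measurable_fun setT (other_departure s t i : N.-tuple (MR * MR) -> R).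
Proof. exact: measurable_departure (measurable_with_self t) _. Qed.

Lemma other_departure_local s t t' i w :
  other_ahead s t i w -> other_ahead s t' i w ->
  other_departure s t i w = other_departure s t' i w.
Proof.
apply: departure_local => j j0.
by have [k ->|jE] := unliftP ord0 j; [rewrite !tnth_with_self|rewrite jE in j0].
Qed.

(** Linearity of expectation: from here on counts are handled through the probabilities of events
    attached to one rank permutation and one other customer. *)
Lemma mean_atE (f : 'S_N.+1 -> N.+1.-tuple (R * R) -> 'I_N.+1 -> nat)
    (e : 'S_N.+1 -> 'I_N -> N.-tuple (MR * MR) -> bool) t :
  (forall s w, f s (with_self t w) ord0 = \sum_i e s i w)%N ->
  (forall s i, measurable_fun setT (e s i)) ->
  mean_at mu_gt0 f F t =
    (N.+1`!%:R)^-1 * \sum_s \sum_i fine (L [set w | e s i w]).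
Proof.
move=> fE me; rewrite /mean_at unlock.
have mE s i : measurable [set w | e s i w].
  by rewrite -[X in measurable X]setTI; exact: (me s i measurableT [set true]).
pose c : R := (N.+1`!%:R)^-1.
have c0 : 0 <= c by rewrite invr_ge0.
have ind s i w : (\1_[set w | e s i w] w : R) = (e s i w)%:R.
  rewrite indicE; suff -> : (w \in [set w | e s i w]) = e s i w by [].
  by apply/idP/idP; rewrite inE.
transitivity (fine (\int[L]_w (c%:E * \sum_s \sum_i (\1_[set w | e s i w] w)%:E))%E).
  congr fine; apply: eq_integral => w _; rewrite EFinM; congr (_ * _)%E.
  rewrite -sumEFin; apply: eq_bigr => s _; rewrite fE natr_sum -sumEFin.
  by apply: eq_bigr => i _; rewrite ind.
have mind s i : measurable_fun setT (fun w => (\1_[set w | e s i w] w : R)%:E).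
  by apply/measurable_EFinP; apply: measurable_indic; exact: mE.
have ind0 s i w : (0 <= (\1_[set w | e s i w] w : R)%:E)%E by rewrite lee_fin.
rewrite ge0_integralZl_EFin//; last 2 first.
- by move=> w _; apply: sume_ge0 => s _; apply: sume_ge0 => i _; exact: ind0.
- by apply: emeasurable_sum => s; apply: emeasurable_sum => i; exact: mind.
rewrite ge0_integral_sum//; last 2 first.
- by move=> s; apply: emeasurable_sum => i; exact: mind.
- by move=> s w _; apply: sume_ge0 => i _; exact: ind0.
have -> : (\sum_s \int[L]_w \sum_i (\1_[set w | e s i w] w)%:E =
    (\sum_s \sum_i fine (L [set w | e s i w]))%:E)%E.
  rewrite -sumEFin; apply: eq_bigr => s _.
  rewrite ge0_integral_sum//; last by move=> i; exact: mind.
  rewrite -sumEFin; apply: eq_bigr => i _.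
  by rewrite integral_indic// setIT fineK// fin_num_measure//.
by [].
Qed.

Lemma others_arrival i (A : set R) : measurable A ->
  L [set w | A (tnth w i).1] = law F A.
Proof.
move=> mA; transitivity ((law F \x S)%E (A `*` setT)).
  rewrite -(iid_tnth (law F \x S)%E i); last exact: measurableX.
  by congr (L _); apply/seteqP; split => w //= -[].
transitivity (law F A * S setT)%E; first exact: product_measure1E.
by rewrite probability_setT mule1.
Qed.

Lemma others_service i (A : set R) : measurable A ->
  L [set w | A (tnth w i).2] = S A.
Proof.
move=> mA; transitivity ((law F \x S)%E (setT `*` A)).
  rewrite -(iid_tnth (law F \x S)%E i); last exact: measurableX.
  by congr (L _); apply/seteqP; split => w //= -[].
transitivity (law F setT * S A)%E; first exact: product_measure1E.
by rewrite probability_setT mul1e.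
Qed.

Lemma others_arrival_service i (A B : set R) : measurable A -> measurable B ->
  L [set w | A (tnth w i).1 /\ B (tnth w i).2] = (law F A * S B)%E.
Proof.
move=> mA mB; transitivity ((law F \x S)%E (A `*` B)); last exact: product_measure1E.
by rewrite -(iid_tnth (law F \x S)%E i)//; exact: measurableX.
Qed.

Lemma measurable_others_arrival i (A : set R) : measurable A ->
  measurable [set w : N.-tuple (MR * MR) | A (tnth w i).1].
Proof.
move=> mA; rewrite -[X in measurable X]setTI.
exact: (measurableT_comp measurable_fst (measurable_tnth i) measurableT).
Qed.

Lemma measurable_others_service i (A : set R) : measurable A ->
  measurable [set w : N.-tuple (MR * MR) | A (tnth w i).2].
Proof.
move=> mA; rewrite -[X in measurable X]setTI.
exact: (measurableT_comp measurable_snd (measurable_tnth i) measurableT).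
Qed.

Definition average (g : 'S_N.+1 -> 'I_N -> R) : R :=
  (N.+1`!%:R)^-1 * \sum_s \sum_i g s i.

Lemma le_average g h : (forall s i, g s i <= h s i) -> average g <= average h.
Proof.
move=> gh; rewrite ler_wpM2l ?invr_ge0//.
by apply: ler_sum => s _; exact: ler_sum.
Qed.

Lemma averageD g h :
  average (fun s i => g s i + h s i) = average g + average h.
Proof.
rewrite /average -mulrDr -big_split; congr (_ * _).
by apply: eq_bigr => s _; rewrite big_split.
Qed.

Lemma average_const_sum g c : (forall s, \sum_i g s i = c) -> average g = c.
Proof.
move=> gc; rewrite /average (eq_bigr (fun=> c)) => [|s _]; last exact: gc.
rewrite sumr_const -/(#|'S_N.+1|) card_Sn -(mulr_natr c).
have fact0 : N.+1`!%:R != 0 :> R by rewrite pnatr_eq0 -lt0n fact_gt0.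
by field.
Qed.

Lemma average_cst c : average (fun _ _ => c) = N%:R * c.
Proof.
by apply: average_const_sum => s; rewrite big_const_ord iter_addr_0 mulr_natl.
Qed.

Lemma average_lt c :
  average (fun s i => c * (s (lift ord0 i) < s ord0)%N%:R) = N%:R * (c / 2).
Proof.
rewrite /average exchange_big/= (eq_bigr (fun=> N.+1`!%:R * (c / 2))); last first.
  by move=> i _; rewrite -mulr_sumr sum_perm_lt//; ring.
rewrite big_const_ord iter_addr_0 -mulr_natr.
have fact0 : N.+1`!%:R != 0 :> R by rewrite pnatr_eq0 -lt0n fact_gt0.
by field.
Qed.

Lemma mean_A_average t : mean_A N mu_gt0 F t =
  average (fun s i => fine (L [set w | other_ahead s t i w])).
Proof.
apply: mean_atE => [s w|s i]; last exact: measurable_other_ahead.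
rewrite /num_ahead -sum1_card big_mkcond big_ord_recl/= inE ahead_irr.
by rewrite add0n; apply: eq_bigr => i _; rewrite inE /other_ahead; case: ahead.
Qed.

Lemma mean_AE t :
  mean_A N mu_gt0 F t = N%:R * (fine (law F `]-oo, t[%classic) + atom F t / 2).
Proof.
have pr s i : fine (L [set w | other_ahead s t i w]) =
    fine (law F `]-oo, t[%classic) + atom F t * (s (lift ord0 i) < s ord0)%N%:R.
  pose A1 := [set w : N.-tuple (MR * MR) | `]-oo, t[%classic (tnth w i).1].
  pose A2 := [set w : N.-tuple (MR * MR) | [set t] (tnth w i).1].
  have mA1 : measurable A1 by apply: measurable_others_arrival.
  have mA2 : measurable A2 by apply: measurable_others_arrival.
  rewrite /atom -!(others_arrival i)//.
  have [st|st] := boolP (s (lift ord0 i) < s ord0)%N.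
    rewrite mulr1 -fine_probabilityU//.
      congr fine; congr (L _); apply/seteqP; split => w/=; rewrite other_aheadE st.
        rewrite andbT; move=> /orP[h|/eqP h].
          by left; rewrite /A1/= in_itv.
        by right.
      by move=> [|->]; [rewrite /A1/= in_itv/= => ->|rewrite eqxx orbT].
    apply/disj_set2P/seteqP; split => w //= [].
    by rewrite /A1/A2/= in_itv/= => /[swap] ->; rewrite ltxx.
  rewrite mulr0 addr0; congr fine; congr (L _); apply/seteqP; split => w/=;
    by rewrite other_aheadE (negbTE st) andbF orbF /A1/= in_itv.
rewrite mean_A_average mulrDr -average_cst -average_lt -averageD /average.
by congr (_ * _); apply: eq_bigr => s _; apply: eq_bigr => i _; exact: pr.
Qed.

Definition present s t i : set (N.-tuple (MR * MR)) :=
  [set w | other_ahead s t i w && (t < other_departure s t i w)].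

Lemma measurable_present s t i : measurable (present s t i).
Proof.
rewrite -[X in measurable X]setTI.
apply: (measurable_and (measurable_other_ahead s t i)
  (measurable_fun_ltr _ (measurable_other_departure s t i))
  measurableT (Y := [set true])) => //.
Qed.

Lemma mean_Q_average t :
  mean_Q N mu_gt0 F t = average (fun s i => fine (L (present s t i))).
Proof.
apply: mean_atE => [s w|s i].
  rewrite /num_present -sum1_card big_mkcond big_ord_recl/= inE ahead_irr/=.
  rewrite add0n; apply: eq_bigr => i _; rewrite inE /other_ahead.
  by rewrite /other_departure arrival_self; case: (_ && _).
apply: measurable_and; first exact: measurable_other_ahead.
by apply: measurable_fun_ltr => //; exact: measurable_other_departure.
Qed.

Lemma service_le_other_departure s t i w : (tnth w i).2 <= other_departure s t i w.
Proof. by rewrite -(service_other t); exact: service_le_departure. Qed.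

Lemma mean_Q_ge0 t : 0 <= mean_Q N mu_gt0 F t.
Proof.
rewrite mean_Q_average -[leLHS](mulr0 N%:R) -average_cst; apply: le_average => s i.
exact: fine_probability_ge0.
Qed.

Lemma mean_Q_le_mean_A t : mean_Q N mu_gt0 F t <= mean_A N mu_gt0 F t.
Proof.
rewrite mean_Q_average mean_A_average; apply: le_average => s i.
apply: le_fine_probability; first exact: measurable_present.
  rewrite -[X in measurable X]setTI.
  exact: (measurable_other_ahead s t i measurableT (Y := [set true])).
by move=> w /andP[].
Qed.

(** A customer who arrives at the same instant and is placed ahead leaves no earlier than [t] plus
    his own service, which is almost surely positive. *)
Lemma atom_le_mean_Q t : N%:R * (atom F t / 2) <= mean_Q N mu_gt0 F t.
Proof.
rewrite mean_Q_average -average_lt; apply: le_average => s i.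
have [st|st] := boolP (s (lift ord0 i) < s ord0)%N; last first.
  by rewrite mulr0; exact: fine_probability_ge0.
have -> : atom F t * 1 = fine (L [set w | [set t] (tnth w i).1 /\
    `]0, +oo[%classic (tnth w i).2]).
  by rewrite others_arrival_service// service_law_gt// mulr0 oppr0 expR0 mule1 mulr1.
apply: le_fine_probability.
- apply: measurableI; first exact: measurable_others_arrival.
  exact: measurable_others_service.
- exact: measurable_present.
move=> w /=; rewrite in_itv/= andbT => -[wt w0].
rewrite /present/= other_aheadE wt ltxx eqxx st/=.
rewrite (lt_le_trans _ (arrival_service_le_departure _ _ _))//.
by rewrite arrival_other service_other wt ltrDl.
Qed.

(** No service starts before time 0, so whoever came before [t] and needs more than [t] units of
    service is still present. The bound ignores queueing altogether. *)
Lemma mean_Q_ge_exp t (A : set R) : 0 <= t -> measurable A -> A `<=` `]-oo, t[ ->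
  N%:R * (fine (law F A) * expR (- (mu * t))) <= mean_Q N mu_gt0 F t.
Proof.
move=> t0 mA At; rewrite mean_Q_average -average_cst; apply: le_average => s i.
have -> : fine (law F A) * expR (- (mu * t)) =
    fine (L [set w | A (tnth w i).1 /\ `]t, +oo[%classic (tnth w i).2]).
  by rewrite others_arrival_service// service_law_gt// fineM// fin_num_measure.
apply: le_fine_probability.
- apply: measurableI; first exact: measurable_others_arrival.
  exact: measurable_others_service.
- exact: measurable_present.
move=> w /=; rewrite in_itv/= andbT => -[wA wt].
rewrite /present/= other_aheadE; move: (At _ wA); rewrite /= in_itv/= => ->/=.
exact: lt_le_trans wt (service_le_other_departure _ _ _ _).
Qed.

End mean.

(** * The queue over an interval without arrivals *)

Section gap.
Context (R : realType) (N : nat) (mu : R) (mu_gt0 : 0 < mu).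
Context (F : cumulativeBounded (0 : R) (1 : R)) (a b : R).
Hypothesis ab : a < b.
Hypothesis Fab : law F `[a, b]%classic = 0%E.
Local Notation L := (others_law N mu_gt0 F).
Local Notation MR := (measurableTypeR R).

Let Z (i : 'I_N) := [set w : N.-tuple (MR * MR) | `[a, b]%classic (tnth w i).1].

Let mZ i : measurable (Z i). Proof. exact: measurable_others_arrival. Qed.

Let Z0 i : L (Z i) = 0%E. Proof. by rewrite others_arrival. Qed.

(** Off the null event [Z i], whoever is ahead at [b] arrived before [a]. He is then ahead at [a]
    too, with the same departure time by [other_departure_local]. *)
Let present_gap s i :
  present s b i `<=` (present s a i `|` Z i : set (N.-tuple (MR * MR))).
Proof.
move=> w /andP[]; rewrite /Z/= in_itv/=.
have [wa bw bd|aw bw bd] := ltP (tnth w i).1 a; last first.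
  by right; rewrite ?aw/=; move: bw; rewrite other_aheadE => /orP[/ltW//|/andP[/eqP->]].
have aw : other_ahead s a i w by rewrite other_aheadE wa.
left; rewrite /present/= aw (other_departure_local aw bw).
exact: lt_trans bd.
Qed.

Lemma mean_Q_gap_le : mean_Q N mu_gt0 F b <= mean_Q N mu_gt0 F a.
Proof.
rewrite !mean_Q_average; apply: le_average => s i.
exact: (@le_fine_probability_null _ _ _ _ _ _ (Z i) (measurable_present _ _ _)
  (measurable_present _ _ _) (mZ i) (Z0 i) (@present_gap s i)).
Qed.

(* With positive probability everybody arrives just before a and all services
   are so short that the queue, nonempty at a, is empty at b. *)
Lemma mean_Q_gap_lt : (0 < N)%N -> 0 <= a -> law_support F a ->
  mean_Q N mu_gt0 F b < mean_Q N mu_gt0 F a.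
Proof.
move=> N0 a0 sa.
have Nr : 0 < N%:R :> R by rewrite ltr0n.
(* Arrivals after [a - e] with services above [e] keep everybody present at [a]; services of at most
   [2 * e] add up to at most [b - a], so all have left by [b]. *)
pose e := (b - a) / (2 * N%:R).
have e0 : 0 < e by rewrite divr_gt0 ?subr_gt0 ?mulr_gt0.
have eN : N%:R * (2 * e) = b - a by rewrite /e; field; rewrite gt_eqF.
pose A : set (MR * MR) := `]a - e, a[%classic `*` `]e, 2 * e]%classic.
have mA : measurable A by exact: measurableX.
pose G := [set w : N.-tuple (MR * MR) | forall i, A (tnth w i)].
have mG : measurable G by exact: measurable_forall_tnth.
have LG : (0 < L G)%E.
  rewrite /others_law iid_forall_tnth// expe_gt0//.
  suff : (0 < (law F \x service_law mu_gt0)%E A)%E by [].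
  have -> : (law F \x service_law mu_gt0)%E A =
      (law F `](a - e)%R, a[%classic * service_law mu_gt0 `]e, (2 * e)%R]%classic)%E.
    exact: product_measure1E.
  rewrite mule_gt0//; last by apply: service_law_itv_gt0; [exact: ltW|lra].
  (* A neighbourhood of the support point [a] has positive mass, and none of it lies in [[a, b]], so
     it lies to the left of [a]. *)
  have : (0 < law F `](a - e)%R, b[%classic)%E.
    by apply: sa; [exact: interval_open|rewrite /= in_itv/= ab ltrBlDr ltrDl e0].
  move=> /lt_le_trans; apply.
  apply: (@le_trans _ _ (law F ((`]a - e, a[%classic : set R) `|` `[a, b]%classic))).
    apply: le_measure; rewrite ?inE//; first exact: measurableU.
    move=> x; rewrite /= !in_itv/= => /andP[-> /ltW xb].
    by case: (ltP x a) => xa; [left|right].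
  apply: le_trans (measureU2 _ _ _) _ => //.
  by rewrite [X in (_ + X)%E]Fab adde0.
have G_absent s i : G `<=` present s a i `\` present s b i.
  move=> w Gw; have svc j : e < (tnth w j).2 <= 2 * e.
    by have [_ /=] := Gw j; rewrite in_itv.
  have arr j : a - e < (tnth w j).1 < a by have [] := Gw j; rewrite /= in_itv.
  have /andP[wa1 wa2] := arr i; have /andP[ws1 ws2] := svc i.
  have ahead_a : other_ahead s a i w by rewrite other_aheadE wa2.
  split; rewrite /present/= ?ahead_a/=.
    have := arrival_service_le_departure s (with_self a w) (lift ord0 i).
    rewrite arrival_other service_other => h; apply: lt_le_trans h; lra.
  apply/negP; rewrite negb_and -leNgt; apply/orP; right.
  have s0 k : 0 <= service (with_self b w) k.
    have [j ->|->] := unliftP ord0 k; last by rewrite service_self.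
    rewrite service_other; have /andP[] := svc j; lra.
  apply: le_trans (departure_le_sum_service s (lift ord0 i) s0) _.
  apply: (@le_trans _ _ (a + \sum_k service (with_self b w) k)).
    rewrite lerD//; first by rewrite ge_max a0 arrival_other ltW.
    by rewrite [leLHS]big_mkcond/= ler_sum// => k _; case: ifP.
  rewrite big_ord_recl service_self add0r.
  apply: (@le_trans _ _ (a + \sum_(j < N) (2 * e))).
    rewrite lerD2l ler_sum// => j _; rewrite service_other.
    by have /andP[] := svc j.
  by rewrite big_const_ord iter_addr_0 -(mulr_natl (2 * e)) eN addrC subrK.
suff : mean_Q N mu_gt0 F b + N%:R * fine (L G) <= mean_Q N mu_gt0 F a.
  apply: lt_le_trans; rewrite ltrDl mulr_gt0// fine_gt0// LG.
  by rewrite ltey_eq fin_num_measure.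
rewrite !mean_Q_average -average_cst -averageD; apply: le_average => s i.
rewrite -fine_probabilityU//; last 2 first.
- exact: measurable_present.
- by apply/disj_set2P/seteqP; split => w //= [wb /(G_absent s i)[_]].
apply: (@le_fine_probability_null _ _ _ _ _ _ (Z i)) => //.
- by apply: measurableU => //; exact: measurable_present.
- exact: measurable_present.
- by move=> w [/present_gap//|/(G_absent s i)[wa _]]; left.
Qed.

End gap.

Lemma measure_bigcup_finType0 d (T : measurableType d) (R : realType)
    (P : {measure set T -> \bar R}) (I : finType) (A : I -> set T) :
  (forall i, measurable (A i)) -> (forall i, P (A i) = 0%E) ->
  measurable (\bigcup_i A i) /\ P (\bigcup_i A i) = 0%E.
Proof.
move=> mA A0.
have -> : \bigcup_i A i = \big[setU/set0]_(i : I) A i.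
  rewrite -bigcup_seq; congr (bigcup _ _); apply/seteqP.
  by split=> [i _|i _] //=; rewrite mem_index_enum.
elim/big_ind : _ => [|B C [mB B0] [mC C0]|i _]; [by split; rewrite ?measure0| |by []].
by split; [exact: measurableU|rewrite measureU0].
Qed.

(** * Arriving just before an atom *)

Section undercut.
Context (R : realType) (N : nat) (alpha gamma mu : R) (mu_gt0 : 0 < mu).
Context (F : cumulativeBounded (0 : R) (1 : R)).
Local Notation L := (others_law N mu_gt0 F).
Local Notation MR := (measurableTypeR R).

(* Given the arrival times, every departure time is one of finitely many
   constants plus a nonempty sum of service times. *)
Lemma other_departure_eq_null s x (i : 'I_N) y :
  L [set w | other_departure s x i w = y] = 0%E.
Proof.
have mE : measurable [set w : N.-tuple (MR * MR) | other_departure s x i w = y].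
  rewrite -[X in measurable X]setTI.
  exact: (measurable_other_departure s x i measurableT (measurable_set1 y)).
rewrite /others_law iid_prodE//; apply: integral0_eq => a _.
(* The possible starts of the busy period: [None] is the opening time and [Some] an arrival. The
   sets [p.1] that miss [i] are given the empty event, because an empty sum of services would not
   yield a null one. *)
pose v (k : option 'I_N.+1) : R :=
  if k is Some k' then if unlift ord0 k' is Some l then tnth a l else x else 0.
pose A (p : {set 'I_N} * option 'I_N.+1) : set (N.-tuple MR) :=
  if i \in p.1 then [set b | \sum_(l in p.1) tnth b l = y - v p.2] else set0.
have mA p : measurable (A p).
  rewrite /A; case: ifP => // _; rewrite -[X in measurable X]setTI.
  exact: (measurable_service_sum p.1 measurableT (measurable_set1 (y - v p.2))).
have A0 p : iid (service_law mu_gt0) N (A p) = 0%E.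
  rewrite /A; case: ifP => // ip; exact: iid_service_sum_eq ip.
have [mU U0] := measure_bigcup_finType0 mA A0.
apply: (@subset_measure0 _ _ _ (iid (service_law mu_gt0) N) _ (\bigcup_p A p)) => //.
  rewrite -[X in measurable X]setTI.
  by have := measurableT_comp (@measurable_tzip _ _ MR MR N) (pair1_measurable a); apply.
move=> b /= yE.
have [m [B [iB _ m0 dE]]] :=
  departure_decomposition s (with_self x (tzip (a, b))) (lift ord0 i).
have [k mk] : exists k, m = v k.
  case: m0 => [->|[k ->]]; first by exists None.
  exists (Some k); rewrite /v; case: unliftP => [l ->|->] //.
  by rewrite arrival_other tnth_mktuple.
exists ([set l | lift ord0 l \in B]%SET, k) => //.
rewrite /A inE iB /= -yE /other_departure dE mk addrC addKr.
rewrite [RHS]big_mkcond big_ord_recl/= service_self if_same add0r big_mkcond.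
by apply: eq_bigr => l _; rewrite inE service_other tnth_mktuple.
Qed.

(** The saving on predecessors is bounded away from 0, whereas the extra queue and the extra wait
    before the opening vanish in the limit. The sequential form lets the conclusion be intersected
    with eventual admissibility. *)
Lemma atom_undercut x : (0 < N)%N -> 0 < alpha -> 0 < gamma -> 0 < atom F x ->
  \forall n \near \oo,
    cost N alpha gamma mu_gt0 F (x - n.+1%:R^-1) < cost N alpha gamma mu_gt0 F x.
Proof.
move=> N0 al0 ga0 p0.
(* Departures in this window account for whoever is met at the earlier time but no longer at [x].
   The windows shrink to the null event of a departure exactly at [x]. *)
pose E s i n := [set w : N.-tuple (MR * MR) |
  x - n.+1%:R^-1 < other_departure s x i w <= x].
have mE s i n : measurable (E s i n).
  rewrite -[X in measurable X]setTI.
  have mD := measurable_other_departure s x i.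
  by apply: (measurable_and (measurable_fun_ltr _ mD) (measurable_fun_ler mD _)
    measurableT (Y := [set true])).
(* Overtaking half of the atom saves [gamma * atom F x * N%:R / 2]. One half of this saving pays for
   the longer queue, through [eps]; the other pays for the earlier arrival, through the bound on
   [n.+1%:R^-1]. *)
pose eps := gamma * atom F x * mu / (4 * alpha).
have eps0 : 0 < eps by rewrite /eps !(divr_gt0, mulr_gt0).
have cvgE s i : fine (L (E s i n)) @[n --> \oo] --> (0:R).
  apply: fine_cvg.
  suff : L (E s i n) @[n --> \oo] --> L [set w | other_departure s x i w = x].
    by rewrite other_departure_eq_null.
  have -> : [set w : N.-tuple (MR * MR) | other_departure s x i w = x] =
      \bigcap_n E s i n.
    apply/seteqP; split => [w /= wx n _|w wE /=].
      by rewrite /E/= wx lexx andbT ltrBlDr ltrDl.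
    apply/eqP; rewrite eq_le; have /andP[_ -> /=] := wE 0%N I.
    rewrite leNgt; apply/negP => dx.
    have e0 : 0 < x - other_departure s x i w by rewrite subr_gt0.
    have [n _ /(_ n (leqnn n)) nd] := near_infty_natSinv_lt (PosNum e0).
    have {}nd : n.+1%:R^-1 < x - other_departure s x i w := nd.
    by have /andP[+ _] := wE n I; rewrite ltrBlDr -ltrBlDl ltNge (ltW nd).
  apply: nonincreasing_cvg_mu => //.
  - by rewrite ltey_eq fin_num_measure.
  - exact: bigcapT_measurable.
  - move=> m n mn; apply/subsetPset => w /andP[h1 h2].
    rewrite /E/= h2 andbT; apply: le_lt_trans h1; rewrite lerD2l lerN2.
    by rewrite lef_pV2 ?posrE// ler_nat.
have tol0 : 0 < gamma * atom F x * N%:R / (4 * alpha).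
  by rewrite !(divr_gt0, mulr_gt0)// ltr0n.
have smallE : \forall n \near \oo, forall s i, fine (L (E s i n)) < eps.
  apply: filter_forall => s; apply: filter_forall => i.
  exact: cvgr_lt (cvgE s i) _ eps0.
near=> n.
have small : forall s i, fine (L (E s i n)) < eps by near: n.
have nsmall : n.+1%:R^-1 < gamma * atom F x * N%:R / (4 * alpha).
  by near: n; exact: near_infty_natSinv_lt (PosNum tol0).
have d0 : 0 < n.+1%:R^-1 :> R by [].
have [d dE] : exists d : R, d = n.+1%:R^-1 by eexists.
rewrite -dE in nsmall d0 *; set t := x - d.
have tx : t < x by rewrite /t ltrBlDr ltrDl.
have Qle : mean_Q N mu_gt0 F t <= mean_Q N mu_gt0 F x + N%:R * eps.
  rewrite !mean_Q_average -average_cst -averageD; apply: le_average => s i.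
  apply: le_trans (lerD (lexx _) (ltW (small s i))).
  apply: (@le_trans _ _ (fine (L (present s x i `|` E s i n)))).
    apply: le_fine_probability; first exact: measurable_present.
      by apply: measurableU => //; exact: measurable_present.
    move=> w /andP[wt td].
    have wx : other_ahead s x i w.
      rewrite other_aheadE; move: wt; rewrite other_aheadE.
      by move=> /orP[/lt_trans->//|/andP[/eqP->]]; rewrite tx.
    move: td; rewrite (other_departure_local wt wx) => td.
    have [dx|xd] := leP (other_departure s x i w) x.
      by right; rewrite /E/= -dE dx td.
    by left; rewrite /present/= wx xd.
  rewrite -lee_fin EFinD -!fine_probabilityE//.
  - by apply: measureU2 => //; exact: measurable_present.
  - exact: measurable_present.
  - by apply: measurableU => //; exact: measurable_present.
have Ale : mean_A N mu_gt0 F t <= mean_A N mu_gt0 F x - N%:R * (atom F x / 2).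
  rewrite !mean_AE -mulrBr ler_wpM2l// addrK.
  have t1 := fine_law_itvNyc F t.
  have t2 : fine (law F `]-oo, t]%classic) <= fine (law F `]-oo, x[%classic).
    apply: le_fine_probability => //; apply: subset_itvl.
    by rewrite bnd_simp.
  have : 0 <= atom F t by exact: fine_probability_ge0.
  lra.
have early : (if t < 0 then - alpha * t else 0) <=
    (if x < 0 then - alpha * x else 0) + alpha * d.
  have ad : 0 < alpha * d by rewrite mulr_gt0.
  have ax : 0 <= x -> 0 <= alpha * x by move=> x0; rewrite mulr_ge0// ltW.
  have ax' : x < 0 -> alpha * x < 0 by move=> x0; rewrite pmulr_rlt0.
  rewrite /t; case: ltP => h1; case: ltP => h2; rewrite ?mulNr ?mulrBr.
  - lra.
  - have := ax h2; lra.
  - have := ax' h2; lra.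
  - lra.
rewrite /cost.
have h1 : alpha / mu * mean_Q N mu_gt0 F t <=
    alpha / mu * mean_Q N mu_gt0 F x + gamma * atom F x * N%:R / 4.
  have -> : gamma * atom F x * N%:R / 4 = alpha / mu * (N%:R * eps).
    by rewrite /eps; field; rewrite !gt_eqF.
  by rewrite -mulrDr ler_pM2l// divr_gt0.
have h2 : alpha * d < gamma * atom F x * N%:R / 4.
  have -> : gamma * atom F x * N%:R / 4 =
      alpha * (gamma * atom F x * N%:R / (4 * alpha)).
    by field; rewrite gt_eqF.
  by rewrite ltr_pM2l.
have h3 : gamma * mean_A N mu_gt0 F t <=
    gamma * mean_A N mu_gt0 F x - gamma * atom F x * N%:R / 4 *+ 2.
  apply: le_trans (ler_wpM2l (ltW ga0) Ale) _.
  by rewrite le_eqVlt; apply/orP; left; apply/eqP; field.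
have add (e e' q q' m m' c k : R) : e' <= e + k -> k < c -> q' <= q + c ->
  m' <= m - c *+ 2 -> e' + q' + m' < e + q + m by lra.
exact: add early h2 h1 h3.
Unshelve. all: by end_near. Qed.

End undercut.

(** * The queue left once everybody has arrived *)

Section erlang.
Context (R : realType) (N : nat) (mu : R) (mu_gt0 : 0 < mu).
Context (F : cumulativeBounded (0 : R) (1 : R)).
Local Notation L := (others_law N mu_gt0 F).
Local Notation MR := (measurableTypeR R).

(** The expected number present is the sum over service positions of the probability of still being
    there. The Poisson weight of index [i] occurs in the tails with [i <= k < N], that is, [N - i]
    times. *)
Lemma q1E t : 0 <= t -> q N mu 1 t = \sum_(k < N) erlang_tail mu k.+1 t.
Proof.
move=> t0; pose p i := expR (- (mu * t)) * (mu * t) ^+ i / i`!%:R.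
have -> : q N mu 1 t = \sum_(i < N.+1) (N - i)%:R * p i.
  rewrite /q big_ord_recr/= big1 ?add0r => [|j _]; last first.
    by rewrite subrr expr0n subn_eq0 leqNgt ltn_ord/= mulr0 mul0r.
  by rewrite binn subnn expr1n expr0 !mul1r; apply: eq_bigr => i _; rewrite /p mulrA.
under [RHS]eq_bigr do rewrite /erlang_tail t0.
elim: N => [|n IH]; first by rewrite big_ord_recl !big_ord0 subnn mul0r addr0.
rewrite [RHS]big_ord_recr/= -IH big_ord_recr/= subnn mul0r addr0 -big_split/=.
by apply: eq_bigr => i _; rewrite subSn -1?ltnS// -natr1 mulrDl mul1r.
Qed.

Section rank.
Context (s : 'S_N.+1) (a : N.-tuple R).
Implicit Types i j l : 'I_N.

(** The order [ahead] among the other customers, written without the services so that these can be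
    integrated with the order frozen. *)
Definition before i j : bool := (tnth a i < tnth a j) ||
  (tnth a i == tnth a j) && (s (lift ord0 i) < s (lift ord0 j))%N.

Lemma before_trans i j l : before i j -> before j l -> before i l.
Proof.
rewrite /before => /orP[ij|/andP[/eqP -> ij]] /orP[jl|/andP[/eqP jl' jl]].
- by rewrite (lt_trans ij jl).
- by rewrite -jl' ij.
- by rewrite jl.
- by rewrite jl' eqxx (ltn_trans ij jl) orbT.
Qed.

Lemma before_irr i : before i i = false.
Proof. by rewrite /before ltxx ltnn andbF. Qed.

Lemma before_total i j : i != j -> before i j || before j i.
Proof.
move=> ij; rewrite /before.
have sij : s (lift ord0 i) != s (lift ord0 j).
  by rewrite (inj_eq perm_inj) (inj_eq lift_inj).
by case: ltgtP => //= _; rewrite -neq_ltn.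
Qed.

Lemma num_before_lt i : (#|[pred l | before l i]| < N)%N.
Proof.
rewrite -[X in (_ < X)%N]card_ord; apply/proper_card/properP; split.
  exact/fintype.subsetP.
by exists i; rewrite // inE before_irr.
Qed.

Definition rank i : 'I_N := Ordinal (num_before_lt i).

(** An injection of ['I_N] into itself is a permutation, so a sum over customers can be reindexed as
    a sum over service positions. *)
Lemma rank_inj : injective rank.
Proof.
have lt i j : before i j -> (rank i < rank j)%N.
  move=> ij; apply/proper_card/properP; split.
    by apply/fintype.subsetP => l; rewrite !inE => /before_trans; apply.
  by exists i; rewrite !inE ?before_irr.
move=> i j rij; apply/eqP; apply: contraTT isT => /before_total.
by move=> /orP[] /lt; rewrite rij ltnn.
Qed.

Definition before_or_self i : {set 'I_N} := [set l | (l == i) || before l i].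

Lemma card_before_or_self i : #|before_or_self i| = (rank i).+1.
Proof.
rewrite (cardsD1 i) inE eqxx add1n; congr _.+1; apply: eq_card => l.
by rewrite !inE; have [->|] := eqVneq l i; rewrite ?before_irr.
Qed.

End rank.

Definition service_ahead s t (i : 'I_N) (w : N.-tuple (R * R)) : R :=
  \sum_(l in ahead_or_self s (with_self t w) (lift ord0 i))
    service (with_self t w) l.

Lemma service_aheadE s t i a b : service_ahead s t i (tzip (a, b)) =
  \sum_(l in before_or_self s a i) tnth b l.
Proof.
rewrite /service_ahead big_mkcond big_ord_recl/= service_self if_same add0r.
rewrite [RHS]big_mkcond; apply: eq_bigr => l _.
rewrite !inE service_other tnth_mktuple (inj_eq lift_inj) /before /ahead.
by rewrite !arrival_other !tnth_mktuple.
Qed.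

(** Presence at [t] as it would be if the server never idled from time 0 on. Unlike true presence,
    its total probability is the same for every arrival law. *)
Definition busy s t i : set (N.-tuple (MR * MR)) := [set w | t < service_ahead s t i w].

Lemma measurable_busy s t i : measurable (busy s t i).
Proof.
rewrite -[X in measurable X]setTI.
have mS : measurable_fun setT (service_ahead s t i : N.-tuple (MR * MR) -> R).
  rewrite /service_ahead; under eq_fun do rewrite big_mkcond.
  apply: measurable_sum => l; apply: measurable_fun_ifT => //; last first.
    exact: (measurable_service (@measurable_with_self _ _ _)).
  under eq_fun do rewrite inE.
  apply: measurable_or; first exact: measurable_cst.
  exact: (measurable_ahead _ (@measurable_with_self _ _ t)).
by apply: (measurable_fun_ltr _ mS measurableT (Y := [set true])).
Qed.

(* The order of service depends only on the arrival times, so the k-th customer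
   to be served is preceded by k - 1 independent service times. *)
Lemma sum_busy s t : 0 <= t -> \sum_i fine (L (busy s t i)) = q N mu 1 t.
Proof.
move=> t0; rewrite q1E//; apply: EFin_inj; rewrite -!sumEFin.
rewrite (eq_bigr (fun i => \int[iid (law F) N]_a
    iid (service_law mu_gt0) N [set b | busy s t i (tzip (a, b))])%E); last first.
  move=> i _; rewrite -fine_probabilityE; last exact: measurable_busy.
  by rewrite /others_law iid_prodE//; exact: measurable_busy.
rewrite -ge0_integral_sum//; last first.
  by move=> i; apply: measurable_iid_section; exact: measurable_busy.
transitivity (\int[iid (law F) N]_a (\sum_(k < N) (erlang_tail mu k.+1 t)%:E))%E.
  apply: eq_integral => a _; rewrite [RHS](reindex_inj (@rank_inj s a)).
  apply: eq_bigr => i _; rewrite -card_before_or_self -iid_service_sum_gt.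
  by congr (iid _ _ _); apply/seteqP; split => b /=; rewrite /busy/= service_aheadE.
rewrite integral_cst//.
by rewrite [X in (_ * X)%E](@probability_setT _ _ _ (iid (law F) N)) mule1.
Qed.

Lemma q1_le_mean_Q t : 0 <= t -> law F `[t, +oo[%classic = 0%E ->
  q N mu 1 t <= mean_Q N mu_gt0 F t.
Proof.
move=> t0 Ft; pose Z i := [set w : N.-tuple (MR * MR) | `[t, +oo[%classic (tnth w i).1].
have mZ i : measurable (Z i) by exact: measurable_others_arrival.
have Z0 i : L (Z i) = 0%E by rewrite others_arrival.
suff : average (fun s i => fine (L (busy s t i))) <= mean_Q N mu_gt0 F t.
  by rewrite (average_const_sum (fun s => sum_busy s t0)).
rewrite mean_Q_average; apply: le_average => s i.
apply: (le_fine_probability_null (measurable_busy s t i) (measurable_present _ _ _)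
  (mZ i) (Z0 i)) => w tw.
have [wt|tw'] := ltP (tnth w i).1 t; last by right; rewrite /Z/= in_itv/= tw'.
left; rewrite /present/= other_aheadE wt/=.
exact: lt_le_trans tw (sum_service_le_departure _ _ _).
Qed.

(** When all arrive at 0 the server has no idle time before the last departure, so the bound of
    [q1_le_mean_Q] is attained. The null event [Z] removes nonzero arrivals and negative
    services. *)
Lemma mean_Q_dirac t : 0 < t -> law F [set 0] = 1%E ->
  mean_Q N mu_gt0 F t = q N mu 1 t.
Proof.
move=> t0 F0.
have F0c : law F (~` [set 0]) = 0%E by rewrite probability_setC// F0 subee.
apply/eqP; rewrite eq_le; apply/andP; split; last first.
  apply: q1_le_mean_Q; first exact: ltW.
  apply: (@subset_measure0 _ _ _ (law F) _ (~` [set 0])) => //.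
  - exact: measurableC.
  - by move=> x /=; rewrite in_itv/= andbT => tx x0; move: tx; rewrite x0 leNgt t0.
suff : mean_Q N mu_gt0 F t <= average (fun s i => fine (L (busy s t i))).
  by rewrite (average_const_sum (fun s => sum_busy s (ltW t0))).
pose Z : set (N.-tuple (MR * MR)) := \bigcup_j
  ([set w | (~` [set 0]) (tnth w j).1] `|` [set w | `]-oo, 0[%classic (tnth w j).2]).
have [mZ Z0] : measurable Z /\ L Z = 0%E.
  have mC : measurable (~` [set 0] : set MR) by exact: measurableC.
  have mA j : measurable [set w : N.-tuple (MR * MR) | (~` [set 0]) (tnth w j).1].
    exact: measurable_others_arrival.
  have mS j : measurable [set w : N.-tuple (MR * MR) | `]-oo, 0[%classic (tnth w j).2].
    exact: measurable_others_service.
  apply: measure_bigcup_finType0 => j; first exact: measurableU.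
  transitivity (L [set w | (~` [set 0]) (tnth w j).1]).
    apply: measureU0; [exact: mA|exact: mS|].
    transitivity (service_law mu_gt0 `]-oo, 0[%classic); last exact: service_law_lt0.
    exact: others_service.
  by rewrite others_arrival.
rewrite mean_Q_average; apply: le_average => s i.
apply: (le_fine_probability_null (measurable_present _ _ _) (measurable_busy s t i)
  mZ Z0) => w /andP[_ td].
have [wZ|wZ] := pselect (Z w); first by right.
left; apply: lt_le_trans td _.
have s0 k : 0 <= service (with_self t w) k.
  have [j ->|->] := unliftP ord0 k; last by rewrite service_self.
  rewrite service_other leNgt; apply/negP => wj; apply: wZ; exists j => //.
  by right; rewrite /= in_itv.
apply: le_trans (departure_le_sum_service s (lift ord0 i) s0) _.
rewrite arrival_other max_l ?add0r// leNgt; apply/negP => wi; apply: wZ.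
by exists i => //; left => /= w0; move: wi; rewrite w0 ltxx.
Qed.

End erlang.

(** * Supports and equilibria *)

Section support.
Context (R : realType) (F : cumulativeBounded (0 : R) (1 : R)).
Local Notation P := (law F).
Implicit Types (x y c : R) (A B : set R).

Lemma law_le0 A : (P A <= 0)%E -> P A = 0%E.
Proof. by move=> A0; apply/eqP; rewrite eq_le A0/=. Qed.

Lemma law_null_subset A B : measurable A -> measurable B -> A `<=` B ->
  P B = 0%E -> P A = 0%E.
Proof. by move=> mA mB AB B0; exact: (@subset_measure0 _ _ _ P A B). Qed.

Lemma law_nullU A B : measurable A -> measurable B ->
  P A = 0%E -> P B = 0%E -> P (A `|` B) = 0%E.
Proof. by move=> mA mB A0 B0; apply: etrans (measureU0 _ _ _) A0. Qed.

Lemma law_bigcup_null (A : nat -> set R) : (forall n, measurable (A n)) ->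
  (forall n, P (A n) = 0%E) -> P (\bigcup_n A n) = 0%E.
Proof.
move=> mA A0; apply: measure_negligible; first exact: bigcupT_measurable.
by apply: negligible_bigcup => n; apply/negligibleP; [exact: mA|exact: A0].
Qed.

Lemma law_setC_eq0 A : measurable A -> P A = 1%E -> P (~` A) = 0%E.
Proof. by move=> mA A1; rewrite probability_setC// A1 subee. Qed.

Lemma law_gt0P A : P A <> 0%E -> (0 < P A)%E.
Proof. by move=> /eqP A0; rewrite lt0e A0/=. Qed.

Lemma notin_support x : ~ law_support F x ->
  exists2 e : R, 0 < e & P `]x - e, x + e[%classic = 0%E.
Proof.
move=> /existsNP[U] /not_implyP[oU] /not_implyP[Ux /negP].
rewrite -leNgt => /law_le0 U0.
have /nbhs_ballP[e /= e0 eU] : nbhs x U by exact: open_nbhs_nbhs.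
exists e => //; apply: law_null_subset U0 => //; first exact: open_measurable.
by rewrite -ball_itv.
Qed.

Lemma support_sub A : closed A -> P A = 1%E -> law_support F `<=` A.
Proof.
move=> cA A1 x sx; apply: contrapT => Ax.
have mA : measurable A by exact: closed_measurable.
have := sx (~` A) (closed_openC cA) Ax.
by rewrite law_setC_eq0// ltxx.
Qed.

Lemma atom_support x : 0 < atom F x -> law_support F x.
Proof.
move=> x0 U oU Ux; apply: (@lt_le_trans _ _ (P [set x])).
  by rewrite fine_probabilityE.
apply: le_measure; rewrite ?inE//; first exact: open_measurable.
by move=> _ ->.
Qed.

Lemma law_set1 x : P [set x] = (atom F x)%:E.
Proof. by rewrite /atom fineK// fin_num_measure. Qed.

(** The point [a] is the left end of the longest null interval ending at [x]; a null neighbourhood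
    of [a] would extend that interval. The interval is open at [a], which may still carry an
    atom. *)
Lemma support_left x c : ~ law_support F x -> (0 < P `]c, x]%classic)%E ->
  exists a, [/\ c < a, a < x, law_support F a & P `]a, x]%classic = 0%E].
Proof.
move=> /notin_support[e e0 xe] cx.
pose E := [set y | y < x /\ P `]y, x]%classic = 0%E].
have Ee : E (x - e).
  split; first by rewrite ltrBlDr ltrDl.
  by apply: law_null_subset xe => //; apply: subset_itvl; rewrite bnd_simp ltrDl.
have Ec : lbound E c.
  move=> y [yx yx0]; rewrite leNgt; apply/negP => yc.
  suff : P `]c, x]%classic = 0%E by move=> c0; rewrite c0 ltxx in cx.
  by apply: law_null_subset yx0 => //; apply: subset_itvr; rewrite bnd_simp ltW.
have hE : has_inf E by split; [exists (x - e)|exists c].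
pose a := inf E.
have ax : P `]a, x]%classic = 0%E.
  apply: (@law_null_subset _ (\bigcup_n `]a + n.+1%:R^-1, x]%classic)) => //.
  - by apply: bigcupT_measurable.
  - move=> z; rewrite /= in_itv/= => /andP[az zx].
    have za : 0 < z - a by rewrite subr_gt0.
    have [n _ /(_ n (leqnn n)) /= nz] := near_infty_natSinv_lt (PosNum za).
    by exists n => //=; rewrite in_itv/= zx andbT addrC -ltrBrDr.
  - apply: law_bigcup_null => // n.
    have n0 : 0 < n.+1%:R^-1 :> R by [].
    have [y [yx yx0] ya] := inf_adherent n0 hE.
    by apply: law_null_subset yx0 => //; apply: subset_itvr; rewrite bnd_simp ltW.
have a_le : a <= x - e by apply: ge_inf => //; exists c.
exists a; split=> //.
- have : c <= a by apply: lb_le_inf => //; exists (x - e).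
  rewrite le_eqVlt => /orP[/eqP ca|//].
  by rewrite ca ax ltxx in cx.
- by rewrite (le_lt_trans a_le)// ltrBlDr ltrDl.
apply: contrapT => /notin_support[r r0 ar].
have : E (a - r).
  split; first by clear - a_le e0 r0; lra.
  apply: law_null_subset (law_nullU _ _ ar ax) => //; first exact: measurableU.
  move=> z; rewrite /= !in_itv/= => /andP[az zx].
  by have [za|za] := leP z a; [left; rewrite az (le_lt_trans za)// ltrDl|right].
move=> /(ge_inf hE.2); rewrite -/a; lra.
Qed.

Lemma law_lt_gt0 A x : measurable A -> (0 < P (A `&` `]-oo, x[%classic))%E ->
  exists2 y, y < x & (0 < P (A `&` `]-oo, y]%classic))%E.
Proof.
move=> mA Ax; apply: contrapT => noy; move: Ax; rewrite lt0e => /andP[/eqP + _].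
apply.
apply: (@law_null_subset _ (\bigcup_n (A `&` `]-oo, x - n.+1%:R^-1]%classic))) => //.
- exact: measurableI.
- by apply: bigcup_measurable => n _; exact: measurableI.
- move=> z [Az]; rewrite /= in_itv/= => zx.
  have xz : 0 < x - z by rewrite subr_gt0.
  have [n _ /(_ n (leqnn n)) /= nz] := near_infty_natSinv_lt (PosNum xz).
  exists n => //=; split => //; rewrite in_itv/= lerBrDr addrC -lerBrDr; exact: ltW.
- apply: law_bigcup_null => n; first exact: measurableI.
  apply: contrapT => /law_gt0P n0; apply: noy; exists (x - n.+1%:R^-1) => //.
  by rewrite ltrBlDr ltrDl.
Qed.

Lemma law_left_tail x : (0 < P `]-oo, x]%classic)%E ->
  exists c, (0 < P `]c, x]%classic)%E.
Proof.
move=> x0; apply: contrapT => noc; move: x0; rewrite lt0e => /andP[/eqP + _]; apply.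
rewrite itvNybndEbigcup; apply: law_bigcup_null => // n.
by apply: contrapT => /law_gt0P n0; apply: noc; exists (- n%:R).
Qed.

End support.

Lemma inf_support (R : realType) (F : cumulativeBounded (0 : R) (1 : R))
  (E : set R) : E `<=` law_support F -> has_inf E -> law_support F (inf E).
Proof.
move=> EF hE; apply: contrapT => /notin_support[e e0 E0].
have [y Ey ye] := inf_adherent e0 hE.
have yinf : inf E <= y by apply: ge_inf => //; exact: hE.2.
have := EF _ Ey `]inf E - e, inf E + e[%classic (interval_open _ _).
rewrite E0 ltxx/= in_itv/= ye andbT => ne.
by suff : false by []; apply: ne => //; rewrite ltrBlDr (le_lt_trans yinf)// ltrDl.
Qed.

Section equilibrium_theory.
Context (R : realType) (N : nat) (alpha gamma mu : R) (mu_gt0 : 0 < mu).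
Hypothesis (N_gt0 : (0 < N)%N) (alpha_gt0 : 0 < alpha) (gamma_gt0 : 0 < gamma).
Context (F : cumulativeBounded (0 : R) (1 : R)).
Local Notation cost := (cost N alpha gamma mu_gt0 F).
Local Notation Q := (mean_Q N mu_gt0 F).
Local Notation A := (mean_A N mu_gt0 F).
Local Notation P := (law F).

Let am_gt0 : 0 < alpha / mu. Proof. exact: divr_gt0. Qed.

Lemma cost_ge0 t : 0 <= t -> cost t = alpha / mu * Q t + gamma * A t.
Proof. by move=> t0; rewrite /Defs.cost ltNge t0 add0r. Qed.

Lemma mean_A_ge0 t : 0 <= A t.
Proof. exact: le_trans (mean_Q_ge0 _ _ _ _) (mean_Q_le_mean_A _ _ _ _). Qed.

(** Since the cost is constant on the support, the wait before the opening bounds the support from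
    below. *)
Lemma cost_ge_early t : - alpha * t <= cost t.
Proof.
rewrite /Defs.cost -addrA.
have : 0 <= alpha / mu * Q t + gamma * A t.
  by rewrite addr_ge0// mulr_ge0 ?mean_A_ge0 ?mean_Q_ge0// ltW.
case: ltP => t0 h; first by rewrite lerDl.
by rewrite add0r (le_trans _ h)// mulNr oppr_le0 mulr_ge0// ltW.
Qed.

Lemma mean_A_gap a b : a < b -> P `[a, b]%classic = 0%E -> A b = A a.
Proof.
move=> ab P0; rewrite !mean_AE.
have atom0 x : a <= x <= b -> atom F x = 0.
  move=> axb; apply: EFin_inj; rewrite -law_set1; apply: law_null_subset P0 => //.
  by move=> _ ->; rewrite /= in_itv.
rewrite !atom0 ?lexx ?(ltW ab)//; congr (_ * (fine _ + _)).
transitivity (P (`]-oo, a[%classic `|` `[a, b[%classic)).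
  by congr (P _); rewrite -itv_bndbnd_setU// bnd_simp ltW.
apply: measureU0 => //; apply: law_null_subset P0 => //.
by apply: subset_itvl; rewrite bnd_simp.
Qed.

(** Strictness has two sources: for [a < 0] the wait before the opening gets shorter, and for
    [0 <= a] the queue drains with positive probability. *)
Lemma cost_gap a b : a < b -> P `[a, b]%classic = 0%E -> law_support F a ->
  cost b < cost a.
Proof.
move=> ab P0 sa; have Ale := mean_A_gap ab P0.
have Qle := mean_Q_gap_le N mu_gt0 ab P0.
have [a0|a0] := ltP a 0; last first.
  have Qlt := mean_Q_gap_lt mu_gt0 ab P0 N_gt0 a0 sa.
  rewrite !cost_ge0// ?(le_trans a0 (ltW ab))// Ale ltrD2r.
  by rewrite ltr_pM2l.
rewrite /Defs.cost Ale ltrD2r a0; apply: ltr_leD; last by rewrite ler_pM2l.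
case: (ltP b 0) => b0; first by rewrite !mulNr ltrN2 ltr_pM2l.
by rewrite mulNr oppr_gt0 pmulr_rlt0.
Qed.

Section properties.
Context (adm : set R) (c_e : R).
Hypothesis eqF : equilibrium N alpha gamma mu_gt0 adm F c_e.

(** The hypothesis on the atom at [a] turns the null interval []a, x]] into the closed one that
    [cost_gap] requires. *)
Lemma equilibrium_no_gap a x : adm x -> a < x -> law_support F a ->
  P `]a, x]%classic = 0%E -> atom F a = 0 -> False.
Proof.
move=> ax ltax sa P0 a0; have [_ _ supc admc] := eqF.
have : cost x < cost a.
  apply: cost_gap => //.
  have -> : `[a, x]%classic = [set a] `|` `]a, x]%classic :> set R.
    by rewrite setU1itv// bnd_simp ltW.
  by apply: law_nullU => //; rewrite law_set1 a0.
by rewrite (supc _ sa) ltNge admc.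
Qed.

Lemma equilibrium_no_atom x : (\forall n \near \oo, adm (x - n.+1%:R^-1)) ->
  atom F x = 0.
Proof.
move=> admx; have [_ _ supc admc] := eqF.
apply/eqP; rewrite eq_le fine_probability_ge0 andbT leNgt; apply/negP => x0.
have /filterI/(_ admx) := atom_undercut mu_gt0 N_gt0 alpha_gt0 gamma_gt0 x0.
move=> [n _ /(_ n (leqnn n))[/=]].
by rewrite (supc _ (atom_support x0)) ltNge => /negP + /admc.
Qed.

End properties.

(** * Equilibria with arrivals before the opening *)

Section early_arrivals.
Context (T c_e : R).
Hypothesis (T_gt0 : 0 < T).
Hypothesis eqF : equilibrium N alpha gamma mu_gt0 `]-oo, T] F c_e.

Let PT : P `]-oo, T]%classic = 1%E. Proof. by have [] := eqF. Qed.

Let supT : law_support F `<=` `]-oo, T].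
Proof. by apply: support_sub PT; exact: interval_closed. Qed.

Let no_atom x : atom F x = 0.
Proof.
have [xT|Tx] := leP x T.
  apply: (equilibrium_no_atom eqF); near=> n; rewrite /= in_itv/=.
  by rewrite lerBlDr (le_trans xT)// lerDl.
apply/eqP; rewrite eq_le fine_probability_ge0 andbT leNgt; apply/negP => x0.
by have := supT (atom_support x0); rewrite /= in_itv/= leNgt Tx.
Unshelve. all: by end_near. Qed.

Let in_support x : x <= T -> (0 < P `]-oo, x]%classic)%E -> law_support F x.
Proof.
move=> xT /law_left_tail[c cx]; apply: contrapT => /support_left/(_ cx)[a].
move=> [_ ax sa P0]; apply: (equilibrium_no_gap eqF _ ax sa P0 (no_atom a)).
by rewrite /= in_itv.
Qed.

Lemma early_equilibrium :
  (exists t_a : R, t_a < - (N%:R * (gamma / alpha)) /\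
     law_support F = `[t_a, T]%classic) /\ N%:R * gamma < c_e.
Proof.
have [_ _ supc _] := eqF.
have sT : law_support F T by apply: in_support; rewrite // PT lte01.
have hinf : has_inf (law_support F).
  split; first by exists T.
  exists (- (c_e / alpha)) => x /supc cx; have := cost_ge_early x.
  by rewrite cx mulNr lerNl => h; rewrite lerNl ler_pdivlMr// mulrC mulrN lerNl.
pose t_a := inf (law_support F).
have sta : law_support F t_a by exact: inf_support.
have ta_le x : law_support F x -> t_a <= x by apply: ge_inf; exact: hinf.2.
have Pta : P `]-oo, t_a[%classic = 0%E.
  apply: contrapT => /law_gt0P; rewrite -[X in P X]setTI => /law_lt_gt0[]// y yta.
  rewrite setTI => yP; have ys := in_support (le_trans (ltW yta) (ta_le _ sT)) yP.
  by move: yta; rewrite ltNge ta_le.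
have Ata : A t_a = 0 by rewrite mean_AE Pta no_atom mul0r addr0 mulr0.
have Qta : Q t_a = 0.
  apply/eqP; rewrite eq_le mean_Q_ge0 andbT -Ata; exact: mean_Q_le_mean_A.
have PltT : fine (P `]-oo, T[%classic) = 1.
  by have := fine_law_itvNyc F T; rewrite PT no_atom addr0.
(* A customer arriving at [T] finds all [N] others ahead, and with positive probability some of them
   are still present. *)
have NT : N%:R * gamma < c_e.
  rewrite -(supc _ sT) cost_ge0 ?ltW// mean_AE PltT no_atom mul0r addr0 mulr1.
  rewrite (mulrC gamma) ltrDr mulr_gt0//.
  apply: lt_le_trans (mean_Q_ge_exp N mu_gt0 F (ltW T_gt0) _ (@subset_refl _ _)) => //.
  by rewrite PltT mul1r mulr_gt0 ?expR_gt0// ltr0n.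
split=> //; exists t_a; split.
  (* Nobody is ahead at [t_a], so [c_e] is the pure early wait [- alpha * t_a]; the bound on [t_a]
     is the bound [NT] on [c_e] divided by [alpha]. *)
  have := supc _ sta; rewrite /Defs.cost Ata Qta !mulr0 !addr0.
  have NTpos : 0 < c_e by apply: lt_trans NT; rewrite mulr_gt0// ltr0n.
  case: ltP => [ta0 ceq|_ c0]; last by move: NTpos; rewrite -c0 ltxx.
  by rewrite ltrNr mulrA ltr_pdivrMr// mulNr (mulrC t_a) -mulNr ceq.
apply/seteqP; split => x.
  move=> sx; rewrite /= in_itv/= ta_le//=.
  by have := supT sx; rewrite /= in_itv.
rewrite /= in_itv/= => /andP[]; rewrite le_eqVlt => /orP[/eqP <-//|tax xT].
apply: in_support => //; apply: lt_le_trans (sta `]-oo, x[%classic _ _) _.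
- exact: interval_open.
- by rewrite /= in_itv.
- by apply: le_measure; rewrite ?inE//; apply: subset_itvl; rewrite bnd_simp.
Qed.

End early_arrivals.

(** * Equilibria without arrivals before the opening *)

Section no_early_arrivals.
Context (T c_e : R).
Hypothesis (T_gt0 : 0 < T).
Hypothesis eqF : equilibrium N alpha gamma mu_gt0 `[0, T] F c_e.
Local Notation p0 := (atom F 0).

Let PT : P `[0, T]%classic = 1%E. Proof. by have [] := eqF. Qed.

Let PC : P (~` `[0, T]%classic) = 0%E. Proof. exact: law_setC_eq0. Qed.

Let supT : law_support F `<=` `[0, T].
Proof. by apply: support_sub PT; exact: interval_closed. Qed.

Let no_atom x : 0 < x -> atom F x = 0.
Proof.
move=> x0; have [xT|Tx] := leP x T.
  apply: (equilibrium_no_atom eqF); near=> n; rewrite /= in_itv/=.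
  rewrite subr_ge0 lerBlDr (le_trans xT) ?lerDl// andbT ltW//.
  by near: n; exact: near_infty_natSinv_lt (PosNum x0).
apply/eqP; rewrite eq_le fine_probability_ge0 andbT leNgt; apply/negP => px.
by have := supT (atom_support px); rewrite /= in_itv/= [x <= T]leNgt Tx andbF.
Unshelve. all: by end_near. Qed.

Let P_lt0 : P `]-oo, 0[%classic = 0%E.
Proof.
apply: law_null_subset PC => //; first exact: measurableC.
by move=> x; rewrite /= !in_itv/= => x0; rewrite leNgt x0.
Qed.

Let P_lt_T : fine (P `]-oo, T[%classic) = 1.
Proof.
have := fine_law_itvNyc F T; rewrite no_atom// addr0 => <-.
suff -> : P `]-oo, T]%classic = 1%E by [].
apply/eqP; rewrite eq_le probability_le1//= -PT.
by apply: le_measure; rewrite ?inE//; apply: subset_itvr; rewrite bnd_simp.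
Qed.

(** Mass is required in []0, x]] so that a gap below [x] would start at a positive point, where
    there is no atom. *)
Let in_support x : x <= T -> (0 < P `]0%R, x]%classic)%E -> law_support F x.
Proof.
move=> xT Px; apply: contrapT => /support_left/(_ Px)[a].
move=> [a0 ax sa P0]; apply: (equilibrium_no_gap eqF _ ax sa P0 (no_atom a0)).
by rewrite /= in_itv/= xT andbT ltW// (lt_trans a0).
Qed.

Let P_gt0_support : p0 < 1 -> (0 < P `]0%R, T]%classic)%E.
Proof.
move=> p01; apply: law_gt0P => P0.
have : P `[0, T]%classic = (p0)%:E.
  have -> : `[0, T]%classic = [set 0] `|` `]0, T]%classic :> set R.
    by rewrite setU1itv// bnd_simp ltW.
  by rewrite -law_set1; apply: measureU0.
by rewrite PT => -[p1]; rewrite -p1 ltxx in p01.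
Qed.

Let T_support : p0 < 1 -> law_support F T.
Proof. by move=> p01; apply: in_support => //; exact: P_gt0_support. Qed.

(** Nobody arrives before 0, and those of the atom who are placed ahead are all still present, so
    [Q 0] is squeezed onto [A 0]. *)
Let cost_0 : cost 0 = (alpha / mu + gamma) * (N%:R * (p0 / 2)).
Proof.
have A0 : A 0 = N%:R * (p0 / 2) by rewrite mean_AE P_lt0 add0r.
have Q0 : Q 0 = N%:R * (p0 / 2).
  by apply/eqP; rewrite eq_le -{1}A0 mean_Q_le_mean_A atom_le_mean_Q.
by rewrite cost_ge0// A0 Q0 mulrDl.
Qed.

Let cost_T : cost T = alpha / mu * Q T + gamma * N%:R.
Proof.
by rewrite cost_ge0 ?ltW// mean_AE P_lt_T no_atom// mul0r addr0 mulr1.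
Qed.

Let Nr_gt0 : 0 < N%:R :> R. Proof. by rewrite ltr0n. Qed.

(** Without an atom arriving at 0 would be free, while the support point [T] costs at least
    [gamma * N%:R]. *)
Lemma atom0_gt0 : 0 < p0.
Proof.
rewrite lt0r fine_probability_ge0 andbT; apply/eqP => p00.
have [_ _ supc admc] := eqF.
have cT := supc _ (T_support _); rewrite p00 in cT.
have {}cT := cT ltr01.
have : c_e <= cost 0 by apply: admc; rewrite /= in_itv/= lexx ltW.
rewrite cost_0 p00 mul0r !mulr0 -cT cost_T leNgt ltr_wpDl ?mulr_gt0//.
by rewrite mulr_ge0 ?mean_Q_ge0// ltW.
Qed.

Let support_0 : law_support F 0. Proof. exact: atom_support atom0_gt0. Qed.

Let atom0_le1 : p0 <= 1.
Proof. by rewrite -lee_fin -law_set1 probability_le1. Qed.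

(* The queue left at T is shortest when everybody arrives at time zero. *)
Lemma atom0_eq1 : N%:R / 2 * (1 - gamma * mu / alpha) <= q N mu 1 T -> p0 = 1.
Proof.
move=> cond; apply/eqP; rewrite eq_le atom0_le1 leNgt; apply/negP => p01.
have [_ _ supc _] := eqF.
have := supc _ (T_support p01); rewrite -(supc _ support_0) cost_T cost_0.
have qQ : q N mu 1 T <= Q T.
  apply: q1_le_mean_Q; first exact: ltW.
  have -> : `[T, +oo[%classic = [set T] `|` `]T, +oo[%classic :> set R.
    by rewrite setU1itv.
  apply: law_nullU => //; first by rewrite law_set1 no_atom.
  apply: law_null_subset PC => //; first exact: measurableC.
  by move=> x; rewrite /= !in_itv/= andbT => Tx; rewrite [x <= T]leNgt Tx andbF.
have h1 : alpha / mu * (N%:R / 2 * (1 - gamma * mu / alpha)) <= alpha / mu * Q T.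
  by rewrite ler_pM2l// (le_trans cond).
(* The threshold is the value of the queue at [T] for which arriving at 0 and arriving at [T] cost
   the same when all others arrive at 0. *)
have h2 : alpha / mu * (N%:R / 2 * (1 - gamma * mu / alpha)) =
    (alpha / mu + gamma) * (N%:R / 2) - gamma * N%:R.
  by field; rewrite !gt_eqF.
have h3 : (alpha / mu + gamma) * (N%:R * (p0 / 2)) <
    (alpha / mu + gamma) * (N%:R / 2).
  by rewrite ltr_pM2l ?addr_gt0// ltr_pM2l// gtr_pMl// invr_gt0.
move=> h4; move: h1 h3; rewrite h2 -h4; lra.
Qed.

(** If all the others came at 0, the queue at [T] would be exactly [q N mu 1 T], and arriving at [T]
    would be cheaper. *)
Lemma atom0_lt1 :
  ~ (N%:R / 2 * (1 - gamma * mu / alpha) <= q N mu 1 T) -> p0 < 1.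
Proof.
move=> /negP; rewrite -ltNge => cond; rewrite lt_neqAle atom0_le1 andbT.
apply/eqP => p01; have [_ _ supc admc] := eqF.
have : cost 0 <= cost T.
  by rewrite (supc _ support_0) admc//= in_itv/= ltW/=.
have P01 : P [set 0] = 1%E by rewrite law_set1 p01.
rewrite cost_0 cost_T mean_Q_dirac// p01.
have h1 : alpha / mu * q N mu 1 T <
    alpha / mu * (N%:R / 2 * (1 - gamma * mu / alpha)).
  by rewrite ltr_pM2l.
have h2 : alpha / mu * (N%:R / 2 * (1 - gamma * mu / alpha)) =
    (alpha / mu + gamma) * (N%:R / 2) - gamma * N%:R.
  by field; rewrite !gt_eqF.
by move: h1; rewrite h2 mul1r; lra.
Qed.

Lemma atom0_eq1_sufficient : alpha / mu <= gamma -> p0 = 1.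
Proof.
move=> amg; apply: atom0_eq1; apply: (@le_trans _ _ 0).
  rewrite mulr_ge0_le0 ?divr_ge0// subr_le0 ler_pdivlMr// mul1r.
  by move: amg; rewrite ler_pdivrMr.
rewrite q1E; last exact: ltW.
by apply: sumr_ge0 => k _; exact: erlang_tail_ge0.
Qed.

(* Just after the atom at zero the cost is larger than at zero, where half of
   the atom is overtaken. *)
Let support_gap x : law_support F x -> x != 0 -> (2 * mu)^-1 <= x.
Proof.
move=> sx x0; have [_ _ supc _] := eqF.
have {x0}x_gt0 : 0 < x.
  by have := supT sx; rewrite /= in_itv/= lt0r x0 => /andP[].
rewrite leNgt; apply/negP => x_lt.
have := supc _ sx; rewrite -(supc _ support_0) cost_0 cost_ge0 ?ltW// mean_AE no_atom//.
have sub : [set 0] `<=` `]-oo, x[ by move=> _ ->; rewrite /= in_itv.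
have hQ := mean_Q_ge_exp N mu_gt0 F (ltW x_gt0) (measurable_set1 0) sub.
have hA : p0 <= fine (P `]-oo, x[%classic) by apply: le_fine_probability.
(* Before [(2 * mu)^-1] each customer of the atom is still present with probability above one half,
   the share met at time 0. Queue and predecessors then both exceed their values at 0. *)
have he : 1 / 2 < expR (- (mu * x)).
  apply: lt_le_trans (expR_ge1Dx _).
  have : mu * x < mu * (2 * mu)^-1 by rewrite ltr_pM2l.
  have -> : mu * (2 * mu)^-1 = 1 / 2 by field; rewrite gt_eqF.
  lra.
rewrite -/p0 in hQ.
have p0_gt0 := atom0_gt0.
have h1 : N%:R * (p0 / 2) < N%:R * (p0 * expR (- (mu * x))).
  by rewrite ltr_pM2l// ltr_pM2l//; lra.
have h2 : alpha / mu * (N%:R * (p0 / 2)) < alpha / mu * Q x.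
  by rewrite ltr_pM2l// (lt_le_trans h1).
have h3 : gamma * (N%:R * (p0 / 2)) <
    gamma * (N%:R * (fine (P `]-oo, x[%classic) + 0 / 2)).
  by rewrite ltr_pM2l// ltr_pM2l// mul0r addr0 (lt_le_trans _ hA)//; lra.
by move=> h4; move: (ltrD h2 h3); rewrite -mulrDl -h4 ltxx.
Qed.

Lemma support_off_0 : p0 < 1 ->
  exists t_e : R, (0 < t_e < T) /\ law_support F `\ 0 = `[t_e, T]%classic.
Proof.
move=> p01; have sT := T_support p01.
pose E := law_support F `\ 0.
have Em x : E x -> (2 * mu)^-1 <= x by move=> [sx /eqP x0]; exact: support_gap.
have hE : has_inf E.
  split; last by exists (2 * mu)^-1.
  by exists T; split => //= T0; move: T_gt0; rewrite T0 ltxx.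
pose t_e := inf E.
have te0 : 0 < t_e.
  apply: (@lt_le_trans _ _ (2 * mu)^-1); first by rewrite invr_gt0 mulr_gt0.
  exact: lb_le_inf hE.1 Em.
have ste : law_support F t_e by apply: inf_support => // x [].
have te_le x : E x -> t_e <= x by apply: ge_inf; exact: hE.2.
have above x : t_e < x -> x <= T -> law_support F x.
  move=> tex xT; apply: in_support => //.
  apply: lt_le_trans (ste `]0, x[%classic _ _) _.
  - exact: interval_open.
  - by rewrite /= in_itv/= te0.
  - by apply: le_measure; rewrite ?inE//; apply: subset_itvl; rewrite bnd_simp.
(* The mass in []0, T]] is not concentrated at [T], which has no atom, so some of it lies below a
   point [y < T], and this [y] is in the support. *)
have teT : t_e < T.
  have itvI c z : `]0, +oo[%classic `&` [set` Interval -oo%O (BSide c z)] =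
      [set` Interval (BRight 0) (BSide c z)] :> set R.
    by apply/seteqP; split => v; rewrite /= !in_itv/= andbT => /andP.
  have : (0 < P (`]0%R, +oo[%classic `&` `]-oo, T[%classic))%E.
    apply: law_gt0P; rewrite itvI => P0; have := P_gt0_support p01.
    have -> : `]0, T]%classic = `]0, T[%classic `|` [set T] :> set R.
      by rewrite setUitv1// bnd_simp.
    by rewrite law_nullU ?ltxx// law_set1 no_atom.
  move=> /law_lt_gt0[]// y yT; rewrite itvI => Py.
  have y0 : 0 < y.
    rewrite ltNge; apply/negP => y0; move: Py.
    by rewrite set_itv_ge ?measure0 ?ltxx// bnd_simp -leNgt.
  apply: le_lt_trans (yT); apply: te_le; split; first exact: in_support (ltW yT) Py.
  by move=> /= y00; move: y0; rewrite y00 ltxx.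
exists t_e; rewrite te0 teT; split => //; apply/seteqP; split => x.
  by move=> Ex; have [/supT + _] := Ex; rewrite /= !in_itv/= te_le// => /andP[].
rewrite /= in_itv/= => /andP[tex xT]; split.
  by move: tex; rewrite le_eqVlt => /orP[/eqP <-//|/above]; apply.
by move=> x0; move: tex; rewrite x0 leNgt te0.
Qed.

End no_early_arrivals.

End equilibrium_theory.

(** * An equilibrium at time zero with [alpha / mu] above [gamma] *)

Section all_at_zero.
Context (R : realType).

Definition unit_step (x : R) : R := (0 <= x)%R%:R.

Let unit_step_nd : nondecreasing unit_step.
Proof.
move=> x y xy; rewrite /unit_step ler_nat; case: (leP 0 x) => // x0.
by rewrite (le_trans x0 xy).
Qed.

Let unit_step_rc : right_continuous unit_step.
Proof.
move=> a; apply: cvg_near_cst; have [a0|a0] := leP 0 a.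
  near=> x; rewrite /unit_step a0 (le_trans a0)//.
near=> x; rewrite /unit_step !leNgt a0.
suff -> : x < 0 by [].
by near: x; exact: nbhs_right_lt.
Unshelve. all: by end_near. Qed.

HB.instance Definition _ :=
  isCumulative.Build R _ R unit_step unit_step_nd unit_step_rc.

Let unit_step_Ny : unit_step @ -oo --> (0 : R).
Proof.
apply: cvg_near_cst; near=> x; rewrite /unit_step leNgt.
suff -> : x < 0 by [].
by near: x; exact: nbhs_ninfty_lt.
Unshelve. all: by end_near. Qed.

Let unit_step_y : unit_step @ +oo --> (1 : R).
Proof.
apply: cvg_near_cst; near=> x; rewrite /unit_step.
suff -> : 0 <= x by [].
by near: x; exact: nbhs_pinfty_ge.
Unshelve. all: by end_near. Qed.

HB.instance Definition _ :=
  isCumulativeBounded.Build R 0 1 unit_step unit_step_Ny unit_step_y.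

Local Notation P := (law unit_step).

Let law_le x : P `]-oo, x]%classic = (unit_step x)%:E.
Proof. by rewrite -cdf_lebesgue_stieltjes_id. Qed.

Lemma law_unit_step : P [set 0] = 1%E.
Proof.
have P_lt0 : P `]-oo, 0[%classic = 0%E.
  apply: contrapT => /law_gt0P; rewrite -[X in P X]setTI => /law_lt_gt0[]// y y0.
  by rewrite setTI law_le /unit_step leNgt y0 ltxx.
have := law_le 0; rewrite {2}/unit_step lexx.
have -> : `]-oo, 0]%classic = [set 0] `|` `]-oo, 0[%classic :> set R.
  by rewrite setUC setUitv1.
by move=> <-; apply/esym; apply: measureU0.
Qed.

(** Here [alpha / mu = 1] exceeds [gamma = 1 / 2]. Arriving at 0 costs [3 / 2], whereas at
    [0 < t <= 1 / 2] the cost is at least [2 * expR (- t) + 1], hence at least [2 * (1 - t) + 1],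
    which is at least 2. *)
Lemma unit_step_equilibrium : equilibrium 2 1 (1 / 2) (@ltr01 R) `[0, 1 / 2]
  unit_step (3 / 2).
Proof.
have atom1 : atom unit_step 0 = 1 by rewrite /atom law_unit_step.
have mC : measurable (~` [set 0] : set R) by exact: measurableC.
have P_lt0 : P `]-oo, 0[%classic = 0%E.
  apply: law_null_subset (law_setC_eq0 _ law_unit_step) => //.
  by move=> x; rewrite /= in_itv/= => x0 x00; rewrite x00 ltxx in x0.
have supp0 : law_support unit_step = [set 0].
  apply/seteqP; split; last first.
    by move=> _ ->; apply: atom_support; rewrite atom1.
  by apply: support_sub law_unit_step; rewrite -set_itv1; exact: interval_closed.
have cost0 : cost 2 1 (1 / 2) (@ltr01 R) unit_step 0 = 3 / 2.
  have A0 : mean_A 2 (@ltr01 R) unit_step 0 = 1.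
    by rewrite mean_AE P_lt0 atom1/=; field.
  have Q0 : mean_Q 2 (@ltr01 R) unit_step 0 = 1.
    apply/le_anti; rewrite (le_trans (mean_Q_le_mean_A _ _ _ _)) ?A0//=.
    apply: le_trans (atom_le_mean_Q _ _ _ _); rewrite atom1; lra.
  by rewrite cost_ge0// A0 Q0; field.
split.
- apply/eqP; rewrite eq_le probability_le1//= -law_unit_step.
  by apply: le_measure; rewrite ?inE// => _ ->; rewrite /= in_itv/= lexx; lra.
- rewrite supp0 => a b; exists (if a <= 0 <= b then [:: (0, 0)] else [::]).
  apply/seteqP; split => x.
    move=> [/= ->]; rewrite in_itv/= => ->; exists (0, 0); first by rewrite /= inE.
    by rewrite /= in_itv/= lexx.
  case: ifP => [ab [I /=]|_ [I] //]; rewrite inE => /eqP -> /=.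
  rewrite in_itv/= => x0; have -> : x = 0 by apply/le_anti; rewrite andbC.
  by split => //; rewrite /= in_itv.
- by move=> t; rewrite supp0 => ->.
move=> t; rewrite /= in_itv/= => /andP[].
rewrite le_eqVlt => /orP[/eqP <-|t0 t1]; first by rewrite cost0.
have sub : [set 0] `<=` `]-oo, t[ by move=> _ ->; rewrite /= in_itv.
have := mean_Q_ge_exp 2 (@ltr01 R) unit_step (ltW t0) (measurable_set1 0) sub.
have P1 : 1 <= fine (P `]-oo, t[%classic).
  by rewrite -{1}atom1; apply: le_fine_probability.
rewrite cost_ge0; last exact: ltW.
rewrite mean_AE law_unit_step/= mul1r.
have := expR_ge1Dx (- (1 * t)).
have : 0 <= atom unit_step t by exact: fine_probability_ge0.
move: (fine _) (atom _ _) (mean_Q _ _ _ _) P1 => p a Q.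
lra.
Qed.

End all_at_zero.

Theorem theorem3p2 (R : realType) (N : nat) (alpha gamma mu T : R)
    (N_ge2 : (2 <= N)%N) (alpha_gt0 : 0 < alpha) (gamma_gt0 : 0 < gamma)
    (mu_gt0 : 0 < mu) (T_gt0 : 0 < T) :
  (forall (F : cumulativeBounded (0 : R) (1 : R)) (c_e : R),
     equilibrium N alpha gamma mu_gt0 `]-oo, T] F c_e ->
     (exists t_a : R,
        t_a < - (N%:R * (gamma / alpha)) /\ law_support F = `[t_a, T]%classic) /\
     N%:R * gamma < c_e) /\
  (forall (F : cumulativeBounded (0 : R) (1 : R)) (c_e : R),
     equilibrium N alpha gamma mu_gt0 `[0, T] F c_e ->
     [/\ 0 < atom F 0,
         (N%:R / 2 * (1 - gamma * mu / alpha) <= q N mu 1 T -> atom F 0 = 1),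
         (~ (N%:R / 2 * (1 - gamma * mu / alpha) <= q N mu 1 T) -> atom F 0 < 1),
         (alpha / mu <= gamma -> atom F 0 = 1)
       & (atom F 0 < 1 ->
          exists t_e : R, (0 < t_e < T) /\ law_support F `\ 0 = `[t_e, T]%classic)]) /\
  (* the condition alpha / mu <= gamma is not necessary for atom F 0 = 1 *)
  (exists (N' : nat) (alpha' gamma' mu' T' : R) (mu'_gt0 : 0 < mu')
          (F : cumulativeBounded (0 : R) (1 : R)) (c_e : R),
     [/\ (2 <= N')%N, 0 < alpha', 0 < gamma' & 0 < T'] /\
     [/\ equilibrium N' alpha' gamma' mu'_gt0 `[0, T'] F c_e,
         atom F 0 = 1 & ~ (alpha' / mu' <= gamma')]).
Proof.
have N_gt0 : (0 < N)%N by exact: ltnW.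
split; first by move=> F c_e; exact: early_equilibrium.
split.
  move=> F c_e eqF; split.
  - exact: atom0_gt0 eqF.
  - exact: atom0_eq1 eqF.
  - exact: atom0_lt1 eqF.
  - exact: atom0_eq1_sufficient eqF.
  - exact: support_off_0 eqF.
exists 2%N, 1, (1 / 2), 1, (1 / 2), ltr01, (@unit_step R), (3 / 2).
split; first by split => //; lra.
split; first exact: unit_step_equilibrium.
  by rewrite /atom law_unit_step.
by apply/negP; rewrite -ltNge; lra.
Qed.
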